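(* Assume the standing assumptions in the context with case (CII). Assume moreover that for every $t'\in(0,T)$ there exist $\tilde c(t')>0$ and $\theta(t')\in(0,1)$ such that $|k_{n,j}(t)-k_{n,j}(s)|\le\tilde c(t')\,\frac{\widetilde w_n\widetilde w_j}{w_{n+j}}(t-s)^{\theta(t')}$ for all $n,j\in\mathbb N$ and $s,t\in[0,t']$. Let $\mathring u\in(\ell^1_{\widetilde w})_+$ and let $u$ be the unique (maximal) mild solution of $u'(t)=G^{(w)}u(t)+K(t,u(t))$, $u(0)=\mathring u$. Then $u$ is also a classical solution of this problem.
   Context: Let $0<T\le\infty$, $a_n\ge0$, $b_{n,j}\ge0$ with $b_{n,j}=0$ for $j\le n$, $k_{n,j}:[0,T)\to[0,\infty)$ continuous with $k_{n,j}=k_{j,n}$. For a positive sequence $v$, $\ell^1_v=\{f:\|f\|_v=\sum v_n|f_n|<\infty\}$ with componentwise order. Weight $w$: $w_n\ge n$, monotone increasing, and $\sum_{n=1}^{j-1}w_nb_{n,j}\le\kappa w_j$ for all $j\ge2$. Case (CII): $\kappa\in(0,1)$, $\alpha\in(0,1)$, $\widetilde w_n=(1+a_n)^\alpha w_n$, and for every $t'\in(0,T)$ there is $c(t')>0$ with $k_{n,j}(t)\le c(t')\widetilde w_n\widetilde w_j/w_{n+j}$ for $t\in[0,t']$. $G^{(w)}=A^{(w)}+B^{(w)}$ on $\ell^1_w$, where $A^{(w)}f=(-a_nf_n)_n$, $B^{(w)}f=(\sum_{j>n}a_jb_{n,j}f_j)_n$ on maximal domains; it generates a substochastic analytic semigroup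 $(S^{(w)}(t))_{t\ge 0}$ on $\ell^1_w$. $K(t,f)=(\tfrac12\sum_{j=1}^{n-1}k_{n-j,j}(t)f_{n-j}f_j-\sum_{j\ge1}k_{n,j}(t)f_nf_j)_n$ for $f\in\ell^1_{\widetilde w}$, with values in $\ell^1_w$. A mild solution on $[0,t_1)$ is $u\in C([0,t_1),\ell^1_{\widetilde w})$ with $u(t)=S^{(w)}(t)\mathring u+\int_0^tS^{(w)}(t-s)K(s,u(s))\,ds$; the maximal mild solution exists and is unique on some $[0,t_{\max})$. A classical solution on $[0,t_1)$ is $u:[0,t_1)\to\ell^1_{\widetilde w}$ continuous, with $u:(0,t_1)\to\ell^1_w$ continuously differentiable, $u(t)\in\mathcal D(G^{(w)})$ and $u'(t)=G^{(w)}u(t)+K(t,u(t))$ for $t\in(0,t_1)$, $u(0)=\mathring u$. *)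

(* Defs.v *)
From mathcomp Require Import all_boot all_order all_algebra.
From mathcomp Require Import all_classical all_reals all_analysis.
Set Implicit Arguments. Unset Strict Implicit. Unset Printing Implicit Defensive.
Import Order.TTheory GRing.Theory Num.Theory.
Import numFieldNormedType.Exports.
Local Open Scope classical_set_scope.
Local Open Scope ring_scope.

(* Convention: sequences are maps nat -> R indexed by n >= 1; the entry at
   index 0 is a dummy, forced to be 0 for elements of the weighted spaces. *)

Section Defs.
Variable R : realType.

Definition seqR := nat -> R.

Definition rseries (m : nat) (F : nat -> R) : R :=
  limn (fun N => \sum_(m <= i < N) F i).
Definition rseries_cvg (m : nat) (F : nat -> R) : Prop :=
  cvgn (fun N => \sum_(m <= i < N) F i).

Definition wsum (v : seqR) (f : seqR) : \bar R :=
  (\sum_(1 <= n <oo) ((v n * `|f n|)%:E))%E.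

Definition inl1 (v : seqR) (f : seqR) : Prop :=
  f 0%N = 0 /\ (wsum v f < +oo)%E.

Definition nonneg_seq (f : seqR) : Prop := forall n, 0 <= f n.

Definition wtilde (alpha : R) (a w : seqR) : seqR :=
  fun n => ((1 + a n) `^ alpha) * w n.

Definition Aop (a : seqR) (f : seqR) : seqR :=
  fun n => if n is 0%N then 0 else - (a n * f n).

Definition Bop (a : seqR) (b : nat -> nat -> R) (f : seqR) : seqR :=
  fun n => if n is 0%N then 0 else rseries n.+1 (fun j => a j * b n j * f j).

Definition Adom (w a : seqR) (f : seqR) : Prop :=
  inl1 w f /\ inl1 w (Aop a f).
Definition Bdom (w a : seqR) (b : nat -> nat -> R) (f : seqR) : Prop :=
  inl1 w f /\ (forall n, (0 < n)%N -> rseries_cvg n.+1 (fun j => a j * b n j * f j))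
  /\ inl1 w (Bop a b f).

Definition Gdom (w a : seqR) (b : nat -> nat -> R) (f : seqR) : Prop :=
  Adom w a f /\ Bdom w a b f.
Definition Gop (a : seqR) (b : nat -> nat -> R) (f : seqR) : seqR :=
  fun n => Aop a f n + Bop a b f n.

Definition Kop (k : nat -> nat -> R -> R) (t : R) (f : seqR) : seqR :=
  fun n => if n is 0%N then 0 else
    2^-1 * (\sum_(1 <= j < n) k (n - j)%N j t * f (n - j)%N * f j)
    - rseries 1 (fun j => k n j t * f n * f j).

Definition generates (v : seqR) (Gd : seqR -> Prop) (Go : seqR -> seqR)
    (S : R -> seqR -> seqR) : Prop :=
  (forall t f, 0 <= t -> inl1 v f -> inl1 v (S t f)) /\
      (forall t f g c, 0 <= t -> inl1 v f -> inl1 v g ->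
          S t (fun n => f n + c * g n) = (fun n => S t f n + c * S t g n)) /\
      (forall t, 0 <= t -> exists M : R, forall f, inl1 v f ->
          (wsum v (S t f) <= M%:E * wsum v f)%E) /\
      (forall f, inl1 v f -> S 0 f = f) /\
      (forall t s f, 0 <= t -> 0 <= s -> inl1 v f -> S (t + s) f = S t (S s f)) /\
      (forall f, inl1 v f ->
          (fun h => wsum v (fun n => S h f n - f n)) @ 0^'+ --> 0%E) /\
  (forall f, inl1 v f -> (Gd f <-> exists g, inl1 v g /\
          (fun h => wsum v (fun n => h^-1 * (S h f n - f n) - g n)) @ 0^'+ --> 0%E)) /\
      (forall f, Gd f ->
          (fun h => wsum v (fun n => h^-1 * (S h f n - f n) - Go f n)) @ 0^'+ --> 0%E).

(* analyticity of the semigroup (real characterisation, Pazy Thm 2.5.2):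
   S(t) maps into D(G) for t>0 and ||G S(t)|| <= C/t for 0 < t <= 1. *)
Definition analytic_sg (v : seqR) (Gd : seqR -> Prop) (Go : seqR -> seqR)
    (S : R -> seqR -> seqR) : Prop :=
  (forall t f, 0 < t -> inl1 v f -> Gd (S t f)) /\
  exists C : R, forall t f, 0 < t <= 1 -> inl1 v f ->
    (wsum v (Go (S t f)) <= (C / t)%:E * wsum v f)%E.

Definition Ico0 (t1 : \bar R) : set R := [set t | 0 <= t /\ (t%:E < t1)%E].
Definition Ioo0 (t1 : \bar R) : set R := [set t | 0 < t /\ (t%:E < t1)%E].

Definition cont_in (v : seqR) (D : set R) (u : R -> seqR) : Prop :=
  forall t, D t -> (fun s => wsum v (fun n => u s n - u t n)) @ within D (nbhs t) --> 0%E.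

(* mild solution on [0, t1): u in C([0,t1), l^1_{w~}) and the variation of
   constants formula, written componentwise (the coordinate maps are bounded
   linear functionals on l^1_w, so they commute with the Bochner integral). *)
Definition mild_sol (w wt : seqR) (S : R -> seqR -> seqR)
    (k : nat -> nat -> R -> R) (u0 : seqR) (t1 : \bar R) (u : R -> seqR) : Prop :=
  [/\ forall t, Ico0 t1 t -> inl1 wt (u t),
      cont_in wt (Ico0 t1) u &
      forall t, Ico0 t1 t -> forall n, (0 < n)%N ->
        u t n = S t u0 n +
          Rintegral lebesgue_measure `[0, t] (fun s => S (t - s) (Kop k s (u s)) n)].

Definition classical_sol (w wt a : seqR) (b : nat -> nat -> R)
    (k : nat -> nat -> R -> R) (u0 : seqR) (t1 : \bar R) (u : R -> seqR) : Prop :=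
  [/\ forall t, Ico0 t1 t -> inl1 wt (u t),
      cont_in wt (Ico0 t1) u,
      u 0 = u0 &
      exists u' : R -> seqR,
        [/\ forall t, Ioo0 t1 t -> inl1 w (u' t),
            (forall t, Ioo0 t1 t ->
              (fun h => wsum w (fun n => h^-1 * (u (t + h) n - u t n) - u' t n))
                @ 0^' --> 0%E),
            cont_in w (Ioo0 t1) u',
            (forall t, Ioo0 t1 t -> Gdom w a b (u t)) &
            (forall t, Ioo0 t1 t -> u' t = fun n => Gop a b (u t) n + Kop k t (u t) n)]].

End Defs.

(* Main.v *)
(** Write F(t) = K(t, u(t)), beta = 1 - alpha, and compare u(t) with the lagged
    function u_eta(t) = S(eta) u(t - eta), which lies in the domain of G.
    Since B is kappa-small relative to A, the graph norm of G controls A, and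
    interpolation gives ||S(t) f||_{w~} <= C t^(beta - 1) ||f||_w.  Hence
    u_eta - u_{2 eta} is O(eta^beta) in the norm of w~; summing over dyadic eta
    and taking eta = sqrt(h) shows that u is Hoelder continuous away from 0 with
    values in l^1_{w~}, so that F is Hoelder continuous with values in l^1_w.
    Then G u_eta(t) + S(eta) F(t) changes by a positive power of eta when eta is
    doubled, so it converges locally uniformly; G being closed, u(t) lies in its
    domain, G u + F is continuous, and it is the derivative of u.

    Integrals of l^1_v-valued functions enter only as additive interval functions
    with a prescribed density, and a bound on the density is integrated by a
    compactness argument on the interval. *)
Require Import Defs.
From mathcomp Require Import all_boot all_order all_algebra.
From mathcomp Require Import all_classical all_reals all_analysis.
From mathcomp Require Import ring lra.
Import Order.TTheory GRing.Theory Num.Theory.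
Import numFieldNormedType.Exports.
Local Open Scope classical_set_scope.
Local Open Scope ring_scope.
Set Implicit Arguments.
Unset Strict Implicit.
Unset Printing Implicit Defensive.

(** The obstacle is the upper end of the convolution: F(s) lies only in l^1_w, and G S(t - s) has
    norm of order 1/(t - s), not integrable at s = t. Doubling the lag avoids the singularity:
    u_y(t) - u_{2y}(t) is S(y) applied to the forcing collected on [t - 2y, t - y], an element of
    l^1_w of size O(y), so a full time y of smoothing is left to spend on it. Towards w~ this costs
    y^(beta - 1), and y^beta is summable over dyadic y. For G it costs 1/y, and O(1) is not
    summable; adding S(eta) F(t) replaces F(s) by F(s) - F(t) and gains a Hoelder power. The choice
    eta = sqrt(h) balances the increment of the lagged part over a step h: half of eta brings the
    orbit into the domain, so that the step costs h/eta in l^1_w, and the other half turns this into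
    h/eta times eta^(beta - 1), which is eta^beta when h = eta^2. Hence F has exponent min(theta,
    beta)/2. Lags may not exceed t, so the estimates hold only away from 0. *)

Lemma seq_evalE {R : realType} :
  [/\ (forall n, (0 : nat -> R) n = 0),
      (forall (f g : nat -> R) n, (f + g) n = f n + g n),
      (forall (f : nat -> R) n, (- f) n = - f n) &
      (forall c (f : nat -> R) n, (c *: f) n = c * f n)].
Proof. by []. Qed.

Definition seqE {R : realType} :=
  let: And4 z a o s := @seq_evalE R in (z, a, o, s).

(** [nb v f B] says that [f] belongs to [l^1_v] with norm at most [B]. *)
Definition nb {R : realType} (v f : nat -> R) (B : R) : Prop :=
  f 0%N = 0 /\ forall N, \sum_(1 <= n < N) v n * `|f n| <= B.

(** * Norm bounds and completeness in weighted l^1 *)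

Section WeightedNorm.
Context {R : realType} (v : nat -> R).
Hypothesis vpos : forall n, (0 < n)%N -> 0 < v n.
Implicit Types (f g : nat -> R) (A B c : R).

Lemma nb_ge0 f B : nb v f B -> 0 <= B.
Proof. by case=> _ /(_ 0%N); rewrite big_geq. Qed.

Lemma nb_le f A B : nb v f A -> A <= B -> nb v f B.
Proof. by move=> [f0 fA] AB; split=> // N; apply: le_trans AB. Qed.

Lemma nb0 : nb v 0 0.
Proof. by split=> // N; rewrite big1 // => n _; rewrite seqE normr0 mulr0. Qed.

Lemma nbD f g A B : nb v f A -> nb v g B -> nb v (f + g) (A + B).
Proof.
move=> [f0 fA] [g0 gB]; split=> [|N]; first by rewrite seqE f0 g0 addr0.
apply: le_trans (lerD (fA N) (gB N)); rewrite -big_split /=.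
apply: ler_sum_nat => n /andP[n1 _].
by rewrite -mulrDr ler_wpM2l ?ler_normD // ltW ?vpos.
Qed.

Lemma nbZ c f B : nb v f B -> nb v (c *: f) (`|c| * B).
Proof.
move=> [f0 fB]; split=> [|N]; first by rewrite seqE f0 mulr0.
under eq_bigr do rewrite seqE normrM mulrCA.
by rewrite -mulr_sumr ler_wpM2l.
Qed.

Lemma nbN f B : nb v f B -> nb v (- f) B.
Proof. by move/(nbZ (-1)); rewrite normrN normr1 mul1r scaleN1r. Qed.

Lemma nbB f g A B : nb v f A -> nb v g B -> nb v (f - g) (A + B).
Proof. by move=> fA /nbN; exact: nbD. Qed.

Lemma nb_coord f B n : (0 < n)%N -> nb v f B -> `|f n| <= (v n)^-1 * B.
Proof.
move=> n0 [_ /(_ n.+1)]; rewrite big_nat_recr //= => fB.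
rewrite ler_pdivlMl ?vpos //; apply: le_trans fB; rewrite lerDr big_nat_cond.
by apply: sumr_ge0 => i /andP[/andP[i1 _] _]; rewrite mulr_ge0 // ltW ?vpos.
Qed.

(** The least bound is the supremum of the partial sums, that is, the norm as a real number. It
    serves to absorb an estimate of the form X <= B + kappa * X. *)
Lemma nb_min f B : nb v f B -> exists2 X, nb v f X & forall Y, nb v f Y -> X <= Y.
Proof.
move=> [f0 fB].
pose E := range (fun N => \sum_(1 <= n < N) v n * `|f n|).
have E0 : E !=set0 by exists (\sum_(1 <= n < 0) v n * `|f n|), 0%N.
exists (sup E); last first.
  by move=> Y [_ fY]; apply: ge_sup => // _ [N _ <-].
split=> // N; apply: sup_upper_bound; last by exists N.
by split=> //; exists B => _ [M _ <-].
Qed.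

Lemma nb_closed f B : (forall e, 0 < e -> nb v f (B + e)) -> nb v f B.
Proof.
move=> fe; split=> [|N]; first by case: (fe 1 ltr01).
by apply/ler_addgt0Pr => e /fe [].
Qed.

Lemma nb_small0 f : (forall e, 0 < e -> nb v f e) -> f = 0.
Proof.
move=> fe; have f0 : nb v f 0 by apply: nb_closed => e; rewrite add0r; exact: fe.
apply/funext => -[|n]; first by case: f0.
apply/eqP; rewrite seqE -normr_le0.
by have := nb_coord (ltn0Sn n) f0; rewrite mulr0.
Qed.

(* The approximation takes place in a second weighted norm, so this is
   lower semicontinuity of one norm along convergence in another. *)
Lemma nb_lsc (v' : nat -> R) (v'pos : forall n, (0 < n)%N -> 0 < v' n) f B :
  (forall e, 0 < e -> exists g, nb v g B /\ nb v' (f - g) e) -> nb v f B.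
Proof.
move=> fg; split=> [|N].
  by have [g [[g0 _] [fg0 _]]] := fg 1 ltr01; rewrite !seqE g0 subr0 in fg0.
apply/ler_addgt0Pr => e e0.
(* A partial sum sees finitely many coordinates, on which the two norms are comparable with constant
   [s]. As [s] may be 0, the error is divided by [s + 1]. *)
pose s := \sum_(1 <= n < N) v n * (v' n)^-1.
have s0 : 0 <= s.
  rewrite /s big_nat_cond; apply: sumr_ge0 => i /andP[/andP[i1 _] _].
  by rewrite mulr_ge0 ?invr_ge0 // ltW ?vpos ?v'pos.
have s1 : 0 < s + 1 by rewrite ltr_wpDl.
have [g [[_ gB] fge]] := fg (e / (s + 1)) (divr_gt0 e0 s1).
apply: (@le_trans _ _ (B + s * (e / (s + 1)))); last first.
  by rewrite lerD2l mulrA ler_pdivrMr // [s * e]mulrC ler_wpM2l ?ltW //; lra.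
rewrite /s mulr_suml; apply: le_trans (lerD (gB N) (lexx _)).
rewrite -big_split /=; apply: ler_sum_nat => n /andP[n1 _].
rewrite -mulrA -mulrDr; apply: ler_wpM2l; first exact: ltW (vpos n1).
have := ler_normD (g n) (f n - g n); rewrite [g n + _]addrC subrK.
move=> /le_trans; apply; rewrite lerD2l; have [_ /(_ n.+1)] := fge.
rewrite big_nat_recr //= !seqE ler_pdivlMl ?v'pos //; apply: le_trans.
rewrite lerDr big_nat_cond.
by apply: sumr_ge0 => i /andP[/andP[i1 _] _]; rewrite mulr_ge0 // ltW ?v'pos.
Qed.

(** In coordinate i the intervals of centre [x n i] and radius [(v i)^-1 * e n] meet pairwise, so
    the supremum of their left ends lies in all of them. The limit keeps the rate [e], which later
    gives uniform convergence. *)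
Lemma nb_complete (x : nat -> nat -> R) (e : nat -> R) :
  (forall n m, (n <= m)%N -> nb v (x m - x n) (e n)) ->
  (forall d n, 0 < d -> exists2 m, (n <= m)%N & e m <= d) ->
  exists l, forall n, nb v (l - x n) (e n).
Proof.
move=> xe e_small.
have e0 n : 0 <= e n by exact: nb_ge0 (xe n n (leqnn n)).
pose E i := range (fun n => x n i - (v i)^-1 * e n).
have Eub n i : (0 < i)%N -> ubound (E i) (x n i + (v i)^-1 * e n).
  move=> i0 _ [m _ <-]; have vi0 := ltW (vpos i0).
  have em : 0 <= (v i)^-1 * e m by rewrite mulr_ge0 ?invr_ge0.
  have en : 0 <= (v i)^-1 * e n by rewrite mulr_ge0 ?invr_ge0.
  have [nm|/ltnW mn] := leqP n m.
    have := nb_coord i0 (xe _ _ nm); rewrite !seqE ler_norml => /andP[]; lra.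
  have := nb_coord i0 (xe _ _ mn); rewrite !seqE ler_norml => /andP[]; lra.
pose l i := if i is 0%N then x 0%N 0%N else sup (E i).
have lx n i : (0 < i)%N -> `|l i - x n i| <= (v i)^-1 * e n.
  move=> i0; have -> : l i = sup (E i) by case: i i0.
  have En : E i (x n i - (v i)^-1 * e n) by exists n.
  have := @ge_sup _ (E i) _ (ex_intro _ _ En) (Eub n i i0).
  have := @sup_upper_bound _ (E i) (conj (ex_intro _ _ En) (ex_intro _ _ (Eub n i i0))) _ En.
  by rewrite ler_norml => ? ?; apply/andP; split; lra.
exists l => n; split=> [|N].
  rewrite !seqE /l; have [] := xe 0%N n (leq0n n).
  by rewrite !seqE => /eqP; rewrite subr_eq0 => /eqP ->; rewrite subrr.
apply/ler_addgt0Pr => d d0.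
have N1 : 0 < N.+1%:R :> R by rewrite ltr0n.
have [m nm em] := e_small (d / N.+1%:R) n (divr_gt0 d0 N1).
have [_ /(_ N) xN] := xe _ _ nm.
apply: (@le_trans _ _ (e n + \sum_(1 <= i < N) e m)); last first.
  rewrite lerD2l sumr_const_nat -mulr_natl.
  apply: (@le_trans _ _ (N.+1%:R * e m)).
    by rewrite ler_wpM2r // ler_nat; apply: leq_trans (leq_subr _ _) _.
  by move: em; rewrite ler_pdivlMr // mulrC.
apply: le_trans (lerD xN (lexx _)); rewrite -big_split /=.
apply: ler_sum_nat => i /andP[i1 _]; rewrite !seqE.
have -> : e m = v i * ((v i)^-1 * e m).
  by rewrite mulrA divff ?mul1r // gt_eqF // vpos.
rewrite -mulrDr; apply: ler_wpM2l; first exact: ltW (vpos i1).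
have := lx m i i1; have := ler_normD (l i - x m i) (x m i - x n i).
rewrite addrA subrK; lra.
Qed.

End WeightedNorm.

(** Compactness as a supremum argument: the points that can be reached from x have a supremum, which
    is itself reached and cannot lie below y. As for tagged partitions, only intervals that contain
    their tag z are required to be good. *)
Lemma interval_chain {R : realType} (x y : R) (P : R -> R -> Prop) : x <= y ->
  (forall p q r, x <= p -> p <= q -> q <= r -> r <= y -> P p q -> P q r -> P p r) ->
  (forall z, x <= z <= y -> exists2 d, 0 < d & forall p q,
     x <= p -> p <= z -> z <= q -> q <= y -> z - d < p -> q < z + d -> P p q) ->
  P x y.
Proof.
move=> xy Ptrans Ploc.
pose A := [set q | x <= q <= y /\ P x q].
have Ax : A x.
  split; first by rewrite lexx.
  have [|d d0 Pd] := Ploc x; first by rewrite lexx.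
  by apply: Pd => //; lra.
have Aub : ubound A y by move=> q [/andP[]].
have Asup : has_sup A by split; [exists x|exists y].
have xs : x <= sup A by exact: sup_upper_bound.
have sy : sup A <= y by apply: ge_sup => //; exists x.
have [|d d0 Pd] := Ploc (sup A); first by rewrite xs sy.
have [q [/andP[xq qy] Pxq] qs] := sup_adherent d0 Asup.
have qsup : q <= sup A by apply: sup_upper_bound => //; split=> //; rewrite xq.
have PA r : sup A <= r -> r <= y -> r < sup A + d -> P x r.
  move=> sr ry rd; apply: (Ptrans _ q) => //; first by lra.
  by apply: Pd => //; lra.
have [<-|sy'] := eqVneq (sup A) y; first by apply: PA => //; lra.
have {sy'} : sup A < y by rewrite lt_neqAle sy'.
move=> sy'; exfalso.
pose r := Num.min y (sup A + d / 2).
have ry : r <= y by rewrite /r ge_min lexx.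
have sr : sup A < r by rewrite /r lt_min sy' /=; lra.
have rd : r <= sup A + d / 2 by rewrite /r ge_min lexx orbT.
have : r <= sup A.
  apply: sup_upper_bound => //; split; first by apply/andP; split=> //; lra.
  by apply: PA => //; lra.
lra.
Qed.

(** * Additive interval functions with a density *)

Section Density.
Context {R : realType}.
Implicit Types (v f : nat -> R) (x y p q z B e : R).

Definition ccont v x y (g : R -> nat -> R) : Prop :=
  forall z e, x <= z <= y -> 0 < e -> exists2 d, 0 < d &
    forall s, x <= s <= y -> `|s - z| < d -> nb v (g s - g z) e.

(** [J p q] plays the role of the integral of [g] over [[p, q]]. *)
Definition density v x y (J : R -> R -> nat -> R) (g : R -> nat -> R) : Prop :=
  (forall p q r, x <= p -> p <= q -> q <= r -> r <= y -> J p r = J p q + J q r) /\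
  (forall z e, x <= z <= y -> 0 < e -> exists2 d, 0 < d & forall p q,
     x <= p -> p <= z -> z <= q -> q <= y -> z - d < p -> q < z + d ->
     nb v (J p q - (q - p) *: g z) (e * (q - p))).

Section Weight.
Context (v : nat -> R).
Hypothesis vpos : forall n, (0 < n)%N -> 0 < v n.

(** A mean value inequality: near each tag [z] the increment is [(q - p) *: g z] up to a small
    multiple of [q - p], and such bounds add up along a chain. *)
Lemma density_bound x y J g B : x <= y -> density v x y J g ->
  (forall z, x <= z <= y -> nb v (g z) B) -> nb v (J x y) (B * (y - x)).
Proof.
move=> xy [Jadd Jloc] gB; apply: nb_closed => e e0.
pose e' := e / (y - x + 1).
have yx1 : 0 < y - x + 1 by lra.
have e'0 : 0 < e' by rewrite divr_gt0.
suff : nb v (J x y) ((B + e') * (y - x)).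
  move=> /nb_le; apply; rewrite mulrDl lerD2l /e' mulrAC ler_pdivrMr //.
  by rewrite ler_wpM2l ?ltW //; lra.
apply: (interval_chain (P := fun p q => nb v (J p q) ((B + e') * (q - p)))) => //.
  move=> p q r xp pq qr ry Jpq Jqr; rewrite (Jadd p q r) //.
  by apply: nb_le (nbD vpos Jpq Jqr) _; lra.
move=> z xzy; have [d d0 Jd] := Jloc z e' xzy e'0; exists d => // p q *.
have -> : J p q = (J p q - (q - p) *: g z) + (q - p) *: g z by rewrite subrK.
apply: nb_le (nbD vpos (Jd p q _ _ _ _ _ _) (nbZ (q - p) (gB z xzy))) _ => //.
by rewrite ger0_norm; lra.
Qed.

Lemma densityB x y J J' g g' : density v x y J g -> density v x y J' g' ->
  density v x y (fun p q => J p q - J' p q) (fun z => g z - g' z).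
Proof.
move=> [Jadd Jloc] [Jadd' Jloc']; split.
  move=> p q r *; rewrite (Jadd p q r) // (Jadd' p q r) //.
  by apply/funext => n; rewrite !seqE; ring.
move=> z e xzy e0.
have e20 : 0 < e / 2 by rewrite divr_gt0.
have [d d0 Jd] := Jloc z (e / 2) xzy e20.
have [d' d'0 Jd'] := Jloc' z (e / 2) xzy e20.
exists (Num.min d d'); first by rewrite lt_min d0.
move=> p q xp pz zq qy; rewrite ltrBlDr -ltrBlDl lt_min => /andP[? ?].
rewrite -ltrBlDl lt_min => /andP[? ?].
have -> : J p q - J' p q - (q - p) *: (g z - g' z) =
  (J p q - (q - p) *: g z) - (J' p q - (q - p) *: g' z).
  by apply/funext => n; rewrite !seqE; ring.
apply: nb_le (nbB vpos (Jd p q _ _ _ _ _ _) (Jd' p q _ _ _ _ _ _)) _ => //; lra.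
Qed.

(** The difference has density 0, hence norm 0. Identities between integrals, such as taking an
    operator under the integral sign, are proved by comparing densities. *)
Lemma density_unique x y J J' g : x <= y -> density v x y J g ->
  density v x y J' g -> J x y = J' x y.
Proof.
move=> xy dJ dJ'; apply/eqP; rewrite -subr_eq0; apply/eqP.
apply: (nb_small0 vpos) => e e0.
have := density_bound (B := 0) xy (densityB dJ dJ').
rewrite mul0r => /(_ _)/nb_le; apply; last exact: ltW.
by move=> z _; rewrite subrr; exact: nb0.
Qed.

Lemma density_cst x y f : density v x y (fun p q => (q - p) *: f) (fun=> f).
Proof.
split=> [p q r *|z e _ e0]; first by rewrite -scalerDl; congr (_ *: _); ring.
exists 1 => // p q *; rewrite subrr; apply: nb_le (nb0 v) _.
by rewrite mulr_ge0 ?(ltW e0) //; lra.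
Qed.

Lemma density_sub x y x' y' J g : x <= x' -> y' <= y ->
  density v x y J g -> density v x' y' J g.
Proof.
move=> xx' y'y [Jadd Jloc]; split=> [p q r *|z e /andP[x'z zy'] e0].
  by apply: Jadd => //; lra.
have [|d d0 Jd] := Jloc z e _ e0; first by apply/andP; split; lra.
by exists d => // p q *; apply: Jd => //; lra.
Qed.

Lemma density_ext x y J J' g g' :
  (forall p q, x <= p -> p <= q -> q <= y -> J p q = J' p q) ->
  (forall z, x <= z <= y -> g z = g' z) ->
  density v x y J g -> density v x y J' g'.
Proof.
move=> JJ' gg' [Jadd Jloc]; split=> [p q r *|z e xzy e0].
  rewrite -(JJ' p q) -?(JJ' q r) -?(JJ' p r) //; [|lra..].
  exact: Jadd.
have [d d0 Jd] := Jloc z e xzy e0; exists d => // p q *.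
rewrite -gg' // -JJ' //; last by lra.
exact: Jd.
Qed.

Lemma ccont_bounded x y g : x <= y -> (forall z, x <= z <= y -> exists B, nb v (g z) B) ->
  ccont v x y g -> exists2 B, 0 < B & forall z, x <= z <= y -> nb v (g z) B.
Proof.
move=> xy gB gc.
apply: (interval_chain (P := fun p q => exists2 B, 0 < B &
  forall z, p <= z <= q -> nb v (g z) B)) => //.
  move=> p q r _ pq qr _ [B B0 gpq] [B' B'0 gqr].
  exists (Num.max B B'); first by rewrite lt_max B0.
  move=> z /andP[pz zr]; have [zq|qz] := leP z q.
    by apply: nb_le (gpq z _) _; [rewrite pz|rewrite le_max lexx].
  by apply: nb_le (gqr z _) _; [rewrite zr ltW|rewrite le_max lexx orbT].
move=> z xzy; have [B gzB] := gB z xzy.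
have [d d0 gd] := gc z 1 xzy ltr01; exists d => // p q *.
have B0 := nb_ge0 gzB.
exists (1 + B); first by lra.
move=> s /andP[ps sq]; rewrite -[g s](subrK (g z)).
apply: (nbD vpos) => //; apply: gd; first by apply/andP; split; lra.
by rewrite ltr_norml; apply/andP; split; lra.
Qed.

End Weight.

(** Operators are total maps on sequences and arbitrary outside the space, so linearity is asked
    only between elements of l^1_v. [M] is some bound, not necessarily the operator norm. *)
Definition blin v v' (L : (nat -> R) -> nat -> R) (M : R) : Prop :=
  (forall c f g, (exists B, nb v f B) -> (exists B, nb v g B) ->
     L (f + c *: g) = L f + c *: L g) /\
  (forall f B, nb v f B -> nb v' (L f) (M * B)).

Section BoundedLinear.
Context (v v' : nat -> R) (L : (nat -> R) -> nat -> R) (M : R).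
Hypothesis vpos : forall n, (0 < n)%N -> 0 < v n.
Hypothesis Lb : blin v v' L M.

Lemma blinD f g A B : nb v f A -> nb v g B -> L (f + g) = L f + L g.
Proof. by move=> fA gB; rewrite -[g]scale1r Lb.1 ?scale1r //; [exists A|exists B]. Qed.

Lemma blinB f g A B : nb v f A -> nb v g B -> L (f - g) = L f - L g.
Proof. by move=> fA gB; rewrite -[- g]scaleN1r Lb.1 ?scaleN1r //; [exists A|exists B]. Qed.

Lemma blin0 : L 0 = 0.
Proof. by have := blinB (nb0 v) (nb0 v); rewrite !subrr. Qed.

Lemma blinZ c f A : nb v f A -> L (c *: f) = c *: L f.
Proof.
move=> fA; rewrite -[c *: f]add0r Lb.1 ?blin0 ?add0r //; last by exists A.
by exists 0; exact: nb0.
Qed.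

Lemma density_blin x y J g : 0 <= M ->
  (forall p q, x <= p -> p <= q -> q <= y -> exists B, nb v (J p q) B) ->
  (forall z, x <= z <= y -> exists B, nb v (g z) B) ->
  density v x y J g -> density v' x y (fun p q => L (J p q)) (fun z => L (g z)).
Proof.
move=> M0 Jb gb [Jadd Jloc]; split=> [p q r xp pq qr ry|z e xzy e0].
  have [|||B1 ?] := Jb p q; [lra..|].
  have [|||B2 ?] := Jb q r; [lra..|].
  by rewrite (Jadd p q r) //; apply: blinD; eassumption.
have M1 : 0 < M + 1 by lra.
have [d d0 Jd] := Jloc z (e / (M + 1)) xzy (divr_gt0 e0 M1).
exists d => // p q *; have [|||B1 ?] := Jb p q; [lra..|].
have [B2 gz] := gb z xzy.
rewrite -(blinZ _ gz) -(blinB (A := B1) (B := `|q - p| * B2)) //; last exact: nbZ.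
apply: nb_le (Lb.2 _ _ (Jd p q _ _ _ _ _ _)) _ => //.
rewrite mulrA ler_wpM2r //; first by lra.
by rewrite mulrA ler_pdivrMr // mulrC ler_wpM2l // ?ltW //; lra.
Qed.

End BoundedLinear.
End Density.

(** * The coordinatewise Lebesgue integral as a density *)

Section Integral.
Context {R : realType}.
Implicit Types (x y p q r B : R) (g : R -> nat -> R).
Local Notation mu := (@lebesgue_measure R).

Lemma itv_integrable x y p q (f : R -> R) : x <= p -> q <= y ->
  {within `[x, y], continuous f} -> mu.-integrable `[p, q] (EFin \o f).
Proof.
move=> xp qy fc; apply: continuous_compact_integrable; first exact: segment_compact.
apply: continuous_subspaceW fc => s /=; rewrite !in_itv /= => /andP[? ?].
by apply/andP; split; lra.
Qed.

Lemma Rintegral_chasles p q r (f : R -> R) : p <= q -> q <= r ->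
  {within `[p, r], continuous f} ->
  Rintegral mu `[p, r] f = Rintegral mu `[p, q] f + Rintegral mu `[q, r] f.
Proof.
move=> pq qr fc.
have <- := @Rintegral_itv_obnd_cbnd _ q (BRight r) f; last first.
  apply: integrableS (itv_integrable (lexx p) (lexx r) fc) => //.
  by apply: subset_itv; rewrite bnd_simp.
rewrite -(@Rintegral_itvB _ f (BLeft p) (BRight r) q) ?bnd_simp //.
  by rewrite addrC subrK.
exact: itv_integrable fc.
Qed.

Lemma Rintegral_itv_cst p q c : p <= q -> Rintegral mu `[p, q] (fun=> c) = (q - p) * c.
Proof.
move=> pq; rewrite Rintegral_cst // mulrC; congr (_ * _).
have := @lebesgue_measure_itv R `[p, q]; rewrite /= lte_fin => ->.
by case: ltgtP pq => // -> _; rewrite subrr.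
Qed.

(** Integration is coordinatewise, as in the formula of [mild_sol]; [density_seqint] makes it an
    integral in l^1_v. *)
Definition seqint (g : R -> nat -> R) (p q : R) : nat -> R :=
  fun n => Rintegral mu `[p, q] (fun s => g s n).

Context (v : nat -> R).
Hypothesis vpos : forall n, (0 < n)%N -> 0 < v n.

Lemma ccont_coord x y g n : (0 < n)%N -> ccont v x y g ->
  {within `[x, y], continuous (fun s => g s n)}.
Proof.
move=> n0 gc; apply/subspace_continuousP => z; rewrite /= in_itv /= => xzy.
apply/cvgrPdist_lt => e e0.
have e20 : 0 < e / 2 by rewrite divr_gt0.
have [d d0 gd] := gc z (v n * (e / 2)) xzy (mulr_gt0 (vpos n0) e20).
suff : nbhs z [set s | `[x, y]%classic s -> `|g z n - g s n| < e] by [].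
apply/nbhs_ballP; exists d => //= s zs xsy; rewrite in_itv /= in xsy.
have sz : `|s - z| < d by rewrite distrC.
rewrite distrC.
apply: le_lt_trans (nb_coord vpos n0 (gd s xsy sz)) _.
by rewrite mulKf ?gt_eqF ?vpos //; lra.
Qed.

(** The triangle inequality for integrals is applied in each coordinate; a finite weighted sum of
    coordinates then passes under the integral, where it is at most [B]. *)
Lemma seqint_bound p q g B : p <= q ->
  (forall n, {within `[p, q], continuous (fun s => g s n)}) ->
  (forall s, p <= s <= q -> nb v (g s) B) -> nb v (seqint g p q) (B * (q - p)).
Proof.
move=> pq gc gB; split=> [|N].
  rewrite /seqint (@eq_Rintegral _ _ _ _ _ (fun=> 0)).
    by rewrite Rintegral_itv_cst // mulr0.
  by move=> s; rewrite inE /= in_itv /= => /gB[].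
have gi n : mu.-integrable `[p, q] (EFin \o (fun s => g s n)).
  exact: itv_integrable (gc n).
have vgi n : mu.-integrable `[p, q] (EFin \o (fun s => v n * `|g s n|)).
  exact: (integrableZl _ (v n) (integrable_norm (gi n))).
have sgi M : mu.-integrable `[p, q] (EFin \o (fun s => \sum_(1 <= n < M) v n * `|g s n|)).
  rewrite (_ : _ \o _ = fun s => (\sum_(1 <= n < M) (v n * `|g s n|)%:E)%E).
    have mI : measurable (`[p, q]%classic : set (measurableTypeR R)) by [].
    have := @integrable_sum _ _ R mu _ mI _ (index_iota 1 M) xpredT
      (fun n s => (v n * `|g s n|)%:E) (fun n _ => vgi n).
    exact.
  by apply/funext => s /=; rewrite sumEFin.
have sum_le M : \sum_(1 <= n < M) v n * `|seqint g p q n| <=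
    Rintegral mu `[p, q] (fun s => \sum_(1 <= n < M) v n * `|g s n|).
  elim: M => [|M IH].
    rewrite big_geq //; under eq_Rintegral do rewrite big_geq //.
    by rewrite Rintegral_itv_cst // mulr0.
  have [->|M0] := posnP M.
    rewrite big_geq //; under eq_Rintegral do rewrite big_geq //.
    by rewrite Rintegral_itv_cst // mulr0.
  rewrite big_nat_recr //=; under eq_Rintegral do rewrite big_nat_recr //=.
  rewrite RintegralD //; apply: lerD IH _; rewrite RintegralZl //; last first.
    exact: integrable_norm (gi M).
  by apply: ler_wpM2l; [exact: ltW (vpos M0)|exact: le_normr_Rintegral].
apply: le_trans (sum_le N) _; rewrite mulrC -Rintegral_itv_cst //.
apply: le_Rintegral => //.
  apply: itv_integrable (lexx p) (lexx q) _ => ?; exact: cvg_cst.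
by move=> s; rewrite /= in_itv /= => /gB[].
Qed.

Lemma density_seqint x y g : ccont v x y g ->
  (forall s, x <= s <= y -> g s 0%N = 0) -> density v x y (seqint g) g.
Proof.
move=> gc g0.
have gcn n : {within `[x, y], continuous (fun s => g s n)}.
  case: n => [|n]; last exact: ccont_coord gc.
  apply: (@subspace_eq_continuous _ _ _ (fun=> 0)); last by move=> ?; exact: cvg_cst.
  by move=> s; rewrite inE /= in_itv /= => /g0 /esym.
split=> [p q r xp pq qr ry|z e xzy e0].
  apply/funext => n; rewrite !seqE /seqint; apply: Rintegral_chasles => //.
  apply: continuous_subspaceW (gcn n); apply: subset_itv; rewrite bnd_simp //.
have [d d0 gd] := gc z e xzy e0; exists d => // p q xp pz zq qy zp qz.
have pq : p <= q by lra.
have gcpq n : {within `[p, q], continuous (fun s => g s n)}.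
  by apply: continuous_subspaceW (gcn n); apply: subset_itv; rewrite bnd_simp.
have -> : seqint g p q - (q - p) *: g z = seqint (fun s => g s - g z) p q.
  apply/funext => n; rewrite !seqE /seqint RintegralB //; last 2 first.
  - exact: itv_integrable (gcpq n).
  - apply: itv_integrable (lexx p) (lexx q) _ => ?; exact: cvg_cst.
  by rewrite Rintegral_itv_cst.
apply: seqint_bound => // [n|s /andP[ps sq]].
  by move=> s; apply: cvgB; [exact: gcpq|exact: cvg_cst].
by apply: gd; [|rewrite ltr_norml]; apply/andP; split; lra.
Qed.

Lemma seqint_nb x y p q g : x <= p -> p <= q -> q <= y -> ccont v x y g ->
  (forall s, x <= s <= y -> exists B, nb v (g s) B) -> exists B, nb v (seqint g p q) B.
Proof.
move=> xp pq qy gc gb; have xy : x <= y by lra.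
have [B B0 gB] := ccont_bounded vpos xy gb gc.
have g0 s : x <= s <= y -> g s 0%N = 0 by move=> /gB[].
have pqB s : p <= s <= q -> nb v (g s) B by move=> ?; apply: gB; lra.
by exists (B * (q - p)); apply: density_bound (density_sub xp qy (density_seqint gc g0)) pqB.
Qed.

End Integral.

(** * Strongly continuous semigroups and their local boundedness *)

Definition sg {R : realType} (v : nat -> R) (S : R -> (nat -> R) -> nat -> R) : Prop :=
  [/\ (forall t, 0 <= t -> exists2 M, 0 <= M & blin v v (S t) M),
      (forall f B, nb v f B -> S 0 f = f),
      (forall t s f B, 0 <= t -> 0 <= s -> nb v f B -> S (t + s) f = S t (S s f)) &
      (forall f B e, nb v f B -> 0 < e -> exists2 d, 0 < d &
         forall h, 0 < h < d -> nb v (S h f - f) e)].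

(** [f] is in the domain of the infinitesimal generator, with value [g]. *)
Definition isgen {R : realType} (v : nat -> R) (S : R -> (nat -> R) -> nat -> R)
    (f g : nat -> R) : Prop :=
  [/\ (exists B, nb v f B), (exists B, nb v g B) &
      forall e, 0 < e -> exists2 d, 0 < d &
        forall h, 0 < h < d -> nb v (S h f - f - h *: g) (e * h)].

Section Semigroup.
Context {R : realType} (v : nat -> R) (S : R -> (nat -> R) -> nat -> R).
Hypothesis vpos : forall n, (0 < n)%N -> 0 < v n.
Hypothesis Ssg : sg v S.
Implicit Types (f g : nat -> R) (B e t h M : R).

(** If [S t g] is huge, [S t] cannot be moderate at both [x + (r / 2) *: g] and [x - (r / 2) *: g],
    whose difference is [r *: g]. A point where it is not becomes the new centre, and the surplus 1
    in [r^-1 + 1] keeps the value above [r^-1] on a small ball around it. *)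
Lemma ball_step x r :
  (forall d M, 0 < d -> 0 <= M -> exists t g, [/\ 0 <= t <= d, nb v g 1 & ~ nb v (S t g) M]) ->
  (exists B, nb v x B) -> 0 < r ->
  exists x' r' t, [/\ (exists B, nb v x' B), 0 < r' <= r / 2, nb v (x' - x) (r / 2),
    0 <= t <= r & forall y B, nb v y B -> nb v (y - x') r' -> ~ nb v (S t y) r^-1].
Proof.
move=> Sunb [Bx xB] r0; have [Sb _ _ _] := Ssg.
have ri0 : 0 < r^-1 by rewrite invr_gt0.
have K0 : 0 <= r^-1 * ((r^-1 + 1) + (r^-1 + 1)) by rewrite mulr_ge0 //; lra.
have [t [g [/andP[t0 tr] g1 Sg]]] := Sunb r _ r0 K0.
have [M M0 SM] := Sb t t0.
have rg : nb v ((r / 2) *: g) (r / 2).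
  by apply: nb_le (nbZ (r / 2) g1) _; rewrite mulr1 ger0_norm //; lra.
have [x' [x'B x'x Sx']] : exists x', [/\ exists B, nb v x' B, nb v (x' - x) (r / 2) &
    ~ nb v (S t x') (r^-1 + 1)].
  have [Sp|Sp] := pselect (nb v (S t (x + (r / 2) *: g)) (r^-1 + 1)); last first.
    exists (x + (r / 2) *: g); split=> //; last by rewrite addrC addKr.
    by exists (Bx + r / 2); exact: nbD.
  exists (x - (r / 2) *: g); split; first by exists (Bx + r / 2); exact: nbB.
    by rewrite addrC addKr; exact: nbN.
  move=> Sm; apply: Sg.
  have -> : S t g = r^-1 *: (S t (x + (r / 2) *: g) - S t (x - (r / 2) *: g)).
    rewrite (blinD SM xB rg) (blinB SM xB rg) (blinZ SM _ g1).
    by apply/funext => n; rewrite !seqE; field; rewrite gt_eqF.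
  apply: nb_le (nbZ _ (nbB vpos Sp Sm)) _; by rewrite ger0_norm // ltW.
have M1 : 0 < M + 1 by lra.
exists x', (Num.min (r / 2) (M + 1)^-1), t; split => //.
- by rewrite lt_min invr_gt0 M1 ge_min lexx !andbT; lra.
- by rewrite t0.
move=> y B yB yx' Sy; apply: Sx'.
have -> : x' = y - (y - x') by rewrite opprB addrC subrK.
rewrite (blinB SM yB yx'); apply: nb_le (nbB vpos Sy (SM.2 _ _ yx')) _.
rewrite lerD2l.
set r' := Num.min _ _; have r'0 : 0 <= r'.
  by rewrite le_min invr_ge0 (ltW M1) andbT; lra.
have : r' * (M + 1) <= 1 by rewrite -ler_pdivlMr // mul1r ge_min lexx orbT.
nra.
Qed.

(* Banach-Steinhaus by nested balls: an unbounded family would be unbounded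
   along times tending to 0 at the common centre. *)
Lemma sg_bound0 : exists d M, [/\ 0 < d, 0 <= M & forall t, 0 <= t <= d -> blin v v (S t) M].
Proof.
have [Sb S0 _ Sc] := Ssg.
apply: contrapT => Hn.
have Sunb d M : 0 < d -> 0 <= M -> exists t g, [/\ 0 <= t <= d, nb v g 1 & ~ nb v (S t g) M].
  move=> d0 M0; apply: contrapT => Hn'; apply: Hn; exists d, M; split=> // t td.
  have [M' _ SM'] := Sb t (andP td).1.
  split; first exact: SM'.1.
  move=> f B fB; have B0 := nb_ge0 fB.
  have [B00|BN0] := eqVneq B 0.
    have -> : f = 0.
      by apply: (nb_small0 vpos) => e e0; apply: nb_le fB _; rewrite B00 ltW.
    by rewrite (blin0 SM') B00 mulr0; exact: nb0.
  have Bp : 0 < B by rewrite lt_neqAle eq_sym BN0.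
  apply: contrapT => Sf; apply: Hn'; exists t, (B^-1 *: f); split=> //.
    by apply: nb_le (nbZ _ fB) _; rewrite ger0_norm ?invr_ge0 // mulVf.
  rewrite (blinZ SM' _ fB) => SBf; apply: Sf.
  have -> : S t f = B *: (B^-1 *: S t f) by rewrite scalerA mulfV // scale1r.
  by apply: nb_le (nbZ _ SBf) _; rewrite ger0_norm // mulrC.
(* A state is a ball whose radius plays three parts: the centre moves by at most half of it, the bad
   time is at most the radius, and the norm at that time exceeds its inverse. *)
pose st := {p : (nat -> R) * R | (exists B, nb v p.1 B) /\ 0 < p.2}.
pose rel (p q : st) := [/\ (sval q).2 <= (sval p).2 / 2,
  nb v ((sval q).1 - (sval p).1) ((sval p).2 / 2) & exists2 t, 0 <= t <= (sval p).2 &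
  forall y B, nb v y B -> nb v (y - (sval q).1) (sval q).2 -> ~ nb v (S t y) (sval p).2^-1].
have relP (p : st) : {q | rel p q}.
  apply: cid; case: p => -[x r] /= [xB r0].
  have [x' [r' [t [x'B /andP[r'0 r'r] x'x tr Sy]]]] := ball_step Sunb xB r0.
  by exists (exist _ (x', r') (conj x'B r'0)); split=> //; exists t.
have [F [_ FP]] := dependent_choice relP (exist _ (0, 1) (conj (ex_intro _ 0 (nb0 v)) ltr01)).
pose x n := (sval (F n)).1; pose r n := (sval (F n)).2.
have r0 n : 0 < r n by rewrite /r; case: (F n) => ? [].
have r2 n : r n.+1 <= r n / 2 by have [] := FP n.
have rS n m : (n <= m)%N -> nb v (x m - x n) (r n - r m).
  elim: m => [|m IH].
    by rewrite leqn0 => /eqP ->; rewrite !subrr; exact: nb0.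
  rewrite leq_eqVlt => /orP[/eqP ->|]; first by rewrite !subrr; exact: nb0.
  rewrite ltnS => /IH {}IH.
  have -> : x m.+1 - x n = (x m.+1 - x m) + (x m - x n) by rewrite addrA subrK.
  have [_ xm _] := FP m; apply: nb_le (nbD vpos xm IH) _.
  by have := r2 m; rewrite -/(r m); lra.
have rn n : n%:R * r n <= r 0%N.
  elim: n => [|n IH]; first by rewrite mul0r ltW.
  have [n0|n0] := posnP n; first by rewrite n0 mul1r; have := r2 0%N; have := r0 0%N; lra.
  apply: le_trans IH; rewrite -natr1.
  have := r2 n; have := r0 n.
  have : 1 <= n%:R :> R by rewrite ler1n.
  nra.
have r_small d n : 0 < d -> exists2 m, (n <= m)%N & r m <= d.
  move=> d0; pose m := maxn n.+1 (Num.truncn (r 0%N / d)).+1.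
  exists m; first by rewrite /m leq_max leqnSn.
  have m0 : (0 < m)%N by rewrite /m leq_max.
  rewrite -(@ler_pM2l _ m%:R) ?ltr0n //; apply: le_trans (rn m) _.
  rewrite -ler_pdivrMr //; apply: le_trans (ltW (truncnS_gt _)) _.
  by rewrite ler_nat /m leq_max leqnn orbT.
have [||l lx] := @nb_complete _ _ vpos x r.
- by move=> n m nm; apply: nb_le (rS _ _ nm) _; rewrite gerBl ltW.
- exact: r_small.
have [Bl lB] : exists B, nb v l B.
  have [B0 xB0] : exists B, nb v (x 0%N) B by rewrite /x; case: (F 0%N) => ? [].
  by exists (r 0%N + B0); rewrite -[l](subrK (x 0%N)); exact: nbD.
have [d d0 Sd] := Sc l Bl 1 lB ltr01.
have Bl1 : 0 < Bl + 1 by have := nb_ge0 lB; lra.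
(* At the common limit [l], strong continuity keeps [S t l] within 1 of [l] for t < d, so its norm
   is at most [Bl + 1]. A ball of radius at most [d / 2] and [(Bl + 1)^-1] asserts the contrary. *)
have d'0 : 0 < Num.min (d / 2) (Bl + 1)^-1 by rewrite lt_min invr_gt0 Bl1 andbT; lra.
have [n _ rnd] := r_small _ 0%N d'0.
have [_ _ [t /andP[t0 tr] St]] := FP n.
apply: (St l Bl lB (lx n.+1)).
have rd : r n <= d / 2 by apply: le_trans rnd _; rewrite ge_min lexx.
have rB : r n <= (Bl + 1)^-1 by apply: le_trans rnd _; rewrite ge_min lexx orbT.
apply: (@nb_le _ _ _ (1 + Bl)); last first.
  by rewrite addrC -[Bl + 1]invrK lef_pV2 // posrE ?invr_gt0 //; exact: r0.
have [->|tN0] := eqVneq t 0; first by rewrite (S0 _ _ lB); apply: nb_le lB _; lra.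
rewrite -[S t l](subrK l); apply: (nbD vpos) lB; apply: Sd.
rewrite lt_neqAle eq_sym tN0 t0 /=; apply: le_lt_trans tr _.
by rewrite -/(r n); lra.
Qed.

(** In [sg] each time has its own bound. The uniform bound near 0 spreads to [0, tau] by
    [S t f = S (t - d) (S d f)]; each step multiplies the constant by [M + 1], which also keeps it
    at least 1. *)
Lemma sg_bound tau : exists2 M, 1 <= M & forall t, 0 <= t <= tau -> blin v v (S t) M.
Proof.
have [_ S0 SD _] := Ssg.
have [d [M [d0 M0 SM]]] := sg_bound0.
have main k : exists2 M, 1 <= M & forall t, 0 <= t <= k%:R * d -> blin v v (S t) M.
  elim: k => [|k [M' M'1 IH]].
    exists (M + 1); first by lra.
    move=> t; rewrite mul0r => /le_anti <-.
    have [L1 L2] : blin v v (S 0) M by apply: SM; rewrite lexx ltW.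
    split=> // f B fB; apply: nb_le (L2 _ _ fB) _.
    by have := nb_ge0 fB; nra.
  exists (M' * (M + 1)); first by nra.
  move=> t /andP[t0 tk].
  have [tk'|tk'] := leP t (k%:R * d).
    have [L1 L2] : blin v v (S t) M' by apply: IH; rewrite t0.
    split=> // f B fB; apply: nb_le (L2 _ _ fB) _.
    rewrite -mulrA ler_wpM2l ?ler_peMl ?(nb_ge0 fB) //; lra.
  have kd : 0 <= k%:R * d by rewrite mulr_ge0 // ltW.
  have dt : 0 <= t - d <= k%:R * d \/ t <= d.
    move: tk; rewrite -natr1 mulrDl mul1r => tk.
    have [?|?] := leP t d; first by right.
    by left; apply/andP; split; lra.
  case: dt => [dt|td].
    have [L1 L2] := IH _ dt; have [N1 N2] : blin v v (S d) M by apply: SM; rewrite lexx (ltW d0).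
    have E f : (exists B, nb v f B) -> S t f = S (t - d) (S d f).
      move=> [B fB]; rewrite -(SD _ _ _ B) ?subrK // ?(ltW d0) //.
      by case/andP: dt.
    split=> [c f g fB gB|f B fB].
      have bS f' : (exists B, nb v f' B) -> exists B, nb v (S d f') B.
        by move=> [B /N2]; exists (M * B).
      have fgB : exists B, nb v (f + c *: g) B.
        case: fB gB => [B1 ?] [B2 ?]; exists (B1 + `|c| * B2).
        by apply: nbD => //; exact: nbZ.
      by rewrite !E // N1 // L1 //; apply: bS.
    rewrite E; last by exists B.
    apply: nb_le (L2 _ _ (N2 _ _ fB)) _; rewrite -mulrA ler_wpM2l //; first by lra.
    by rewrite ler_wpM2r ?(nb_ge0 fB) //; lra.
  have [N1 N2] : blin v v (S t) M by apply: SM; rewrite t0.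
  split=> // f B fB; apply: nb_le (N2 _ _ fB) _.
  by rewrite ler_wpM2r ?(nb_ge0 fB) //; nra.
have [M' M'1 SM'] := main (Num.truncn (tau / d)).+1.
exists M' => // t /andP[t0 tt]; apply: SM'; rewrite t0 /= -ler_pdivrMr //.
apply: ltW; apply: le_lt_trans (truncnS_gt (tau / d)).
by rewrite ler_wpM2r // invr_ge0 ltW.
Qed.

End Semigroup.

(** * Orbits and the infinitesimal generator *)

Section SemigroupCalculus.
Context {R : realType} (v : nat -> R) (S : R -> (nat -> R) -> nat -> R).
Hypothesis vpos : forall n, (0 < n)%N -> 0 < v n.
Hypothesis Ssg : sg v S.
Implicit Types (f g : nat -> R) (A B e t h M : R).

Lemma sg_nb t f B : 0 <= t -> nb v f B -> exists B', nb v (S t f) B'.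
Proof. by case: Ssg => Sb _ _ _ /Sb[M _ SM] /SM.2; exists (M * B). Qed.

Lemma sgD t f g A B : 0 <= t -> nb v f A -> nb v g B -> S t (f + g) = S t f + S t g.
Proof. by case: Ssg => Sb _ _ _ /Sb[M _ SM]; exact: (blinD SM). Qed.

Lemma sgB t f g A B : 0 <= t -> nb v f A -> nb v g B -> S t (f - g) = S t f - S t g.
Proof. by case: Ssg => Sb _ _ _ /Sb[M _ SM]; exact: (blinB SM). Qed.

Lemma sgZ t c f A : 0 <= t -> nb v f A -> S t (c *: f) = c *: S t f.
Proof. by case: Ssg => Sb _ _ _ /Sb[M _ SM]; exact: (blinZ SM). Qed.

Lemma sg_cont0 f B e : nb v f B -> 0 < e -> exists2 d, 0 < d &
  forall h, 0 <= h < d -> nb v (S h f - f) e.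
Proof.
have [_ S0 _ Sc] := Ssg; move=> fB e0; have [d d0 Sd] := Sc f B e fB e0.
exists d => // h /andP[h0 hd]; have [->|hN0] := eqVneq h 0.
  by rewrite (S0 _ _ fB) subrr; apply: nb_le (nb0 v) _; rewrite ltW.
by apply: Sd; rewrite lt_neqAle eq_sym hN0 h0.
Qed.

Lemma sg_joint_cont t (g : R -> nat -> R) : (forall s, 0 <= s <= t -> exists B, nb v (g s) B) ->
  ccont v 0 t g -> ccont v 0 t (fun s => S (t - s) (g s)).
Proof.
have [_ _ SD _] := Ssg; move=> gb gc z e zt e0.
have [B gzB] := gb z zt.
have [M M1 SM] := sg_bound vpos Ssg t.
have M2 : 0 < 2 * M by lra.
have eM0 : 0 < e / (2 * M) by rewrite divr_gt0.
have [d1 d10 gd] := gc z _ zt eM0.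
have [d2 d20 Sd] := sg_cont0 gzB eM0.
exists (Num.min d1 d2); first by rewrite lt_min d10.
move=> s st; rewrite lt_min => /andP[sd1 sd2].
have [B' gsB] := gb s st.
have tz0 : 0 <= t - z by lra.
have ts0 : 0 <= t - s by lra.
have eM : M * (e / (2 * M)) = e / 2 by field; rewrite gt_eqF //; lra.
have Sbnd r f : 0 <= r <= t -> nb v f (e / (2 * M)) -> nb v (S r f) (e / 2).
  by move=> rt /(SM r rt).2; rewrite eM.
have -> : S (t - s) (g s) - S (t - z) (g z) =
   S (t - s) (g s - g z) + (S (t - s) (g z) - S (t - z) (g z)).
  by rewrite (sgB ts0 gsB gzB) addrA subrK.
have e2 : e = e / 2 + e / 2 by lra.
rewrite e2; apply: (nbD vpos); first by apply: Sbnd; [lra|exact: gd].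
(* Of the times [t - s] and [t - z] the longer is factored through the shorter, so that continuity
   at 0 and the uniform bound suffice. *)
have [sz|zs] := leP s z.
  have -> : S (t - s) (g z) = S (t - z) (S (z - s) (g z)).
    by rewrite -(SD _ _ _ B) //; [congr (S _ _); ring|lra].
  have zs0 : 0 <= z - s by lra.
  have [B2 ?] := sg_nb zs0 gzB.
  rewrite -(sgB (A := B2) (B := B)) //; apply: Sbnd; first by lra.
  by apply: Sd; rewrite zs0 /=; move: sd2; rewrite ltr_norml => /andP[]; lra.
have -> : S (t - z) (g z) = S (t - s) (S (s - z) (g z)).
  by rewrite -(SD _ _ _ B) //; [congr (S _ _); ring|lra].
have sz0 : 0 <= s - z by lra.
have [B2 ?] := sg_nb sz0 gzB.
rewrite -(sgB (A := B) (B := B2)) //; apply: Sbnd; first by lra.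
rewrite -opprB; apply: nbN.
by apply: Sd; rewrite sz0 /=; move: sd2; rewrite ltr_norml => /andP[]; lra.
Qed.

Lemma isgen_unique f g g' : isgen v S f g -> isgen v S f g' -> g = g'.
Proof.
move=> [_ _ fg] [_ _ fg']; apply/eqP; rewrite -subr_eq0; apply/eqP.
apply: (nb_small0 vpos) => e e0; have e20 : 0 < e / 2 by lra.
have [d d0 gd] := fg _ e20; have [d' d'0 gd'] := fg' _ e20.
pose h := Num.min d d' / 2; have h0 : 0 < h by rewrite divr_gt0 // lt_min d0.
have hd : h < d by rewrite /h; have : Num.min d d' <= d; [rewrite ge_min lexx|lra].
have hd' : h < d' by rewrite /h; have : Num.min d d' <= d'; [rewrite ge_min lexx orbT|lra].
have := nbZ h^-1 (nbB vpos (gd' h _) (gd h _)); rewrite h0 => /(_ hd' hd).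
have -> : h^-1 *: (S h f - f - h *: g' - (S h f - f - h *: g)) = g - g'.
  by apply/funext => n; rewrite !seqE; field; rewrite gt_eqF.
move/nb_le; apply; rewrite gtr0_norm ?invr_gt0 //.
by rewrite [leLHS](_ : _ = e) //; field; rewrite gt_eqF.
Qed.

Lemma isgen_lin c f f' g g' : isgen v S f g -> isgen v S f' g' ->
  isgen v S (f + c *: f') (g + c *: g').
Proof.
move=> [[A fA] [B gB] fg] [[A' fA'] [B' gB'] fg']; split.
- by exists (A + `|c| * A'); apply: nbD => //; exact: nbZ.
- by exists (B + `|c| * B'); apply: nbD => //; exact: nbZ.
move=> e e0; have c1 : 0 < `|c| + 1 by rewrite ltr_wpDl.
have e'0 : 0 < e / (`|c| + 1) by rewrite divr_gt0.
have [d d0 gd] := fg _ e'0; have [d' d'0 gd'] := fg' _ e'0.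
exists (Num.min d d'); first by rewrite lt_min d0.
move=> h /andP[h0]; rewrite lt_min => /andP[hd hd'].
rewrite (sgD (ltW h0) fA (nbZ c fA')) (sgZ _ (ltW h0) fA').
have -> : S h f + c *: S h f' - (f + c *: f') - h *: (g + c *: g') =
  (S h f - f - h *: g) + c *: (S h f' - f' - h *: g').
  by apply/funext => n; rewrite !seqE; ring.
apply: nb_le (nbD vpos (gd h _) (nbZ c (gd' h _))) _; rewrite ?h0 //.
by rewrite [leLHS](_ : _ = e * h) //; field; rewrite gt_eqF.
Qed.

Lemma isgen_sg t f g : 0 <= t -> isgen v S f g -> isgen v S (S t f) (S t g).
Proof.
move=> t0 [[A fA] [B gB] fg]; have [Sb _ SD _] := Ssg.
split; [exact: sg_nb fA|exact: sg_nb gB|move=> e e0].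
have [M M0 SM] := Sb t t0; have M1 : 0 < M + 1 by lra.
have [d d0 gd] := fg _ (divr_gt0 e0 M1); exists d => // h hd.
have h0 : 0 <= h by case/andP: hd => /ltW.
have [C Sh] := sg_nb h0 fA.
have -> : S h (S t f) - S t f - h *: S t g = S t (S h f - f - h *: g).
  rewrite (sgB t0 (nbB vpos Sh fA) (nbZ h gB)) (sgB t0 Sh fA) (sgZ _ t0 gB).
  by rewrite -(SD h t _ A) // -(SD t h _ A) // [h + t]addrC.
apply: nb_le (SM.2 _ _ (gd h hd)) _; rewrite mulrA ler_wpM2r //.
by rewrite mulrA ler_pdivrMr // mulrC ler_wpM2l ?(ltW e0) //; lra.
Qed.

(** An orbit in the domain is the integral of the orbit of [g]. The expansion is made at the left
    end [p], by [S q f = S p (S (q - p) f)], and strong continuity moves it to the tag [z]. *)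
Lemma density_orbit tau f g : isgen v S f g ->
  density v 0 tau (fun p q => S q f - S p f) (fun z => S z g).
Proof.
move=> [[A fA] [B gB] fg]; have [_ _ SD _] := Ssg.
split=> [p q r *|z e ztau e0]; first by rewrite [RHS]addrC addrA subrK.
have [M M1 SM] := sg_bound vpos Ssg tau.
have e2M0 : 0 < e / (2 * M) by rewrite divr_gt0 //; lra.
have [d d0 gd] := fg _ e2M0.
have [d' d'0 Sd'] := sg_cont0 gB e2M0.
exists (Num.min (d / 2) d'); first by rewrite lt_min d'0 andbT; lra.
move=> p q p0 pz zq qtau zp qz.
have hd1 : q - p < d.
  by have : Num.min (d / 2) d' <= d / 2; [rewrite ge_min lexx|lra].
have hd2 : z - p < d'.
  by have : Num.min (d / 2) d' <= d'; [rewrite ge_min lexx orbT|lra].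
have eM : M * (e / (2 * M)) = e / 2 by field; rewrite gt_eqF //; lra.
have [<-|pq] := eqVneq p q.
  by rewrite !subrr scale0r subrr mulr0; exact: nb0.
have {}pq : p < q by rewrite lt_neqAle pq; lra.
have qp0 : 0 <= q - p by lra.
have zp0 : 0 <= z - p by lra.
have [C Sh] := sg_nb qp0 fA; have [D Sg] := sg_nb zp0 gB.
have -> : S q f - S p f - (q - p) *: S z g =
  S p (S (q - p) f - f - (q - p) *: g) - (q - p) *: S p (S (z - p) g - g).
  rewrite (sgB p0 (nbB vpos Sh fA) (nbZ _ gB)) (sgB p0 Sh fA) (sgZ _ p0 gB).
  rewrite (sgB p0 Sg gB) -(SD p _ _ A) // -(SD p _ _ B) //.
  rewrite ![p + _]addrC !subrK.
  by apply/funext => n; rewrite !seqE; ring.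
have ptau : 0 <= p <= tau by lra.
have b1 : nb v (S p (S (q - p) f - f - (q - p) *: g)) (e / 2 * (q - p)).
  rewrite -eM -mulrA; apply: (SM p ptau).2; apply: gd.
  by apply/andP; split; lra.
have b2 : nb v (S p (S (z - p) g - g)) (e / 2).
  by rewrite -eM; apply: (SM p ptau).2; apply: Sd'; apply/andP; split; lra.
apply: nb_le (nbB vpos b1 (nbZ (q - p) b2)) _.
by rewrite ger0_norm //; lra.
Qed.

(** Here [g'] need not be the generator's value: 0 gives a Lipschitz bound for the orbit, and a
    nearby value gives the error of a linear approximation. *)
Lemma isgen_increment f g g' h B : isgen v S f g -> 0 <= h ->
  (exists A, nb v g' A) ->
  (forall r, 0 <= r <= h -> nb v (S r g - g') B) -> nb v (S h f - f - h *: g') (B * h).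
Proof.
move=> fg h0 [A g'A] Sg; have [_ S0 _ _] := Ssg.
have [[C fC] _ _] := fg.
have := density_bound vpos h0 (densityB vpos (density_orbit h fg) (density_cst v 0 h g')) Sg.
by rewrite !subr0 (S0 _ _ fC).
Qed.

(** The step [d] depends only on [g] and [e], through strong continuity, while the approximant is
    chosen after [h]. The errors from [f - f2] can thus be made arbitrarily small for each [h], and
    [nb_closed] removes them. *)
Lemma isgen_closed f g : (forall e, 0 < e -> exists f' g',
    [/\ isgen v S f' g', nb v (f - f') e & nb v (g - g') e]) -> isgen v S f g.
Proof.
move=> app; have [Sb S0 SD _] := Ssg.
have [f1 [g1 [[[A1 f1A] [B1 g1B] _] ff1 gg1]]] := app 1 ltr01.
have fA : nb v f (1 + A1) by rewrite -[f](subrK f1); exact: nbD.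
have gB : nb v g (1 + B1) by rewrite -[g](subrK g1); exact: nbD.
split; [by exists (1 + A1)|by exists (1 + B1)|move=> e e0].
have e20 : 0 < e / 2 by lra.
have [d d0 Sd] := sg_cont0 gB e20.
exists d => // h /andP[h0 hd]; apply: (nb_closed) => e' e'0.
have [M M1 SM] := sg_bound vpos Ssg h.
have MM0 : 0 < M + 1 + M * h by nra.
pose e1 := Num.min (e' / (M + 1 + M * h)) (e / 2 / M).
have e10 : 0 < e1 by rewrite lt_min !divr_gt0 //; lra.
have [f2 [g2 [fg2 ff2 gg2]]] := app e1 e10.
have [[A2 f2A] [B2 g2B] _] := fg2.
have hh : 0 <= h <= h by rewrite ltW //=.
have e1M : M * e1 <= e / 2.
  by rewrite mulrC -ler_pdivlMr ?ge_min ?lexx ?orbT //; lra.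
have e1M' : e1 * (M + 1 + M * h) <= e'.
  by rewrite -ler_pdivlMr ?ge_min ?lexx.
have inc : nb v (S h f2 - f2 - h *: g) ((e / 2 + e / 2) * h).
  apply: (isgen_increment fg2 (ltW h0)); first by exists (1 + B1).
  move=> r /andP[r0 rh].
  have -> : S r g2 - g = (S r g - g) - S r (g - g2).
    by rewrite (sgB r0 gB g2B) opprB [RHS]addrC addrA subrK.
  have rh' : 0 <= r <= h by rewrite r0.
  apply: nb_le (nbB vpos (Sd r _) ((SM r rh').2 _ _ gg2)) _; last by rewrite lerD2l.
  by rewrite r0 /=; lra.
have -> : S h f - f - h *: g = (S h (f - f2) - (f - f2)) + (S h f2 - f2 - h *: g).
  by rewrite (sgB (ltW h0) fA f2A); apply/funext => n; rewrite !seqE; ring.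
apply: nb_le (nbD vpos (nbB vpos ((SM h hh).2 _ _ ff2) ff2) inc) _.
have : M * h * e1 >= 0 by rewrite !mulr_ge0 // ltW //; lra.
move: e1M'; lra.
Qed.

End SemigroupCalculus.

(** * The variation of constants formula on subintervals *)

Section MildDensity.
Context {R : realType} (v : nat -> R) (S : R -> (nat -> R) -> nat -> R).
Hypothesis vpos : forall n, (0 < n)%N -> 0 < v n.
Hypothesis Ssg : sg v S.

Lemma density_reverse x y c J g : density v x y J g ->
  density v (c - y) (c - x) (fun p q => J (c - q) (c - p)) (fun z => g (c - z)).
Proof.
move=> [Jadd Jloc]; split=> [p q r *|z e xzy e0].
  by rewrite [RHS]addrC; apply: Jadd; lra.
have [|d d0 Jd] := Jloc (c - z) e _ e0; first by lra.
exists d => // p q *.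
have -> : q - p = c - p - (c - q) by ring.
by apply: Jd; lra.
Qed.

(* The variation of constants formula on every subinterval at once. *)
Lemma mild_density tau (u F : R -> nat -> R) (u0 : nat -> R) B :
  nb v u0 B -> ccont v 0 tau F ->
  (forall s, 0 <= s <= tau -> exists B, nb v (F s) B) ->
  (forall t, 0 <= t <= tau -> u t = S t u0 + seqint (fun s => S (t - s) (F s)) 0 t) ->
  forall t, 0 <= t <= tau ->
    density v 0 t (fun p q => S (t - q) (u q) - S (t - p) (u p)) (fun z => S (t - z) (F z)).
Proof.
move=> u0B Fc Fb uE t tt; have [Sb _ SD _] := Ssg.
have Fct p : 0 <= p <= tau -> ccont v 0 p (fun s => S (p - s) (F s)).
  move=> pt; apply: sg_joint_cont => // [s sp|z e zp e0]; first by apply: Fb; lra.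
  have [|d d0 Fd] := Fc z e _ e0; first by lra.
  by exists d => // s sp; apply: Fd; lra.
have SFb p s : 0 <= p <= tau -> 0 <= s <= p -> exists B, nb v (S (p - s) (F s)) B.
  move=> pt sp; have [|B' FB] := Fb s; first by lra.
  by apply: sg_nb FB => //; lra.
have SF0 p s : 0 <= p <= tau -> 0 <= s <= p -> S (p - s) (F s) 0%N = 0.
  by move=> pt sp; have [B' [-> _]] := SFb p s pt sp.
have SFd p : 0 <= p <= tau ->
    density v 0 p (seqint (fun s => S (p - s) (F s))) (fun s => S (p - s) (F s)).
  by move=> pt; apply: density_seqint => // [|s sp]; [exact: Fct|exact: SF0].
(* [S (t - p)] is taken under the integral by comparing densities on [0, p]: both sides have density
   [S (t - z) (F z)]. *)
have key p : 0 <= p <= t -> S (t - p) (u p) = S t u0 + seqint (fun s => S (t - s) (F s)) 0 p.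
  move=> pt; have pt' : 0 <= p <= tau by lra.
  have tp0 : 0 <= t - p by lra.
  have p0 : 0 <= p by lra.
  have [M M0 SM] := Sb _ tp0.
  have Ib a b : 0 <= a -> a <= b -> b <= p ->
      exists B, nb v (seqint (fun s => S (p - s) (F s)) a b) B.
    move=> a0 ab bp; apply: (seqint_nb vpos (x := 0) (y := p)) => //; first exact: Fct.
    by move=> s sp; exact: SFb.
  rewrite uE //; have [B1 Su0] := sg_nb Ssg p0 u0B.
  have [B2 Ip] := Ib 0 p (lexx _) p0 (lexx _).
  rewrite (sgD Ssg tp0 Su0 Ip) -(SD _ _ _ B) // subrK; congr (_ + _).
  have D1 := density_blin SM M0 Ib (fun z => SFb p z pt') (SFd p pt').
  have D2 := density_sub (lexx 0) (andP pt).2 (SFd t tt).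
  apply: (density_unique vpos p0 D1); apply: density_ext D2 => // z zp.
  have [|B' FB] := Fb z; first by lra.
  by rewrite -(SD _ _ _ B') //; [congr (S _ _); ring|lra].
apply: density_ext (SFd t tt) => // p q p0 pq qt.
rewrite !key; [|lra..].
have [Jadd _] := SFd t tt; rewrite (Jadd 0 p q) //.
by apply/funext => n; rewrite !seqE; ring.
Qed.

End MildDensity.

(** * Regularity of mild solutions in an abstract parabolic setting *)

Section Parabolic.
Context {R : realType}.

(* The constant [K' = K / (2 `^ b - 1)] solves [K' * ((2 y) `^ b - y `^ b) = K * y `^ b]. *)
Lemma dyadic_telescope (v : nat -> R) (x : R -> nat -> R) (K b eta : R) :
  (forall n, (0 < n)%N -> 0 < v n) -> 0 <= K -> 0 < b -> 0 < eta ->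
  (forall y, 0 < y -> 2 * y <= eta -> nb v (x y - x (2 * y)) (K * y `^ b)) ->
  forall n m, (n <= m)%N -> nb v (x (eta / 2 ^+ m) - x (eta / 2 ^+ n))
    (K / (2 `^ b - 1) * (eta / 2 ^+ n) `^ b).
Proof.
move=> vpos K0 b0 eta0 xd n m nm.
have b1 : 0 < 2 `^ b - 1.
  have : 1 `^ b < 2 `^ b :> R by apply: gt0_ltr_powR; rewrite ?nnegrE //; lra.
  by rewrite powR1 subr_gt0.
have y0 k : 0 < eta / 2 ^+ k by rewrite divr_gt0 // exprn_gt0.
have K'0 : 0 <= K / (2 `^ b - 1) by rewrite divr_ge0 // ltW.
(* The induction is on a difference of powers, which telescopes; the subtracted power is dropped at
   the end. *)
have : nb v (x (eta / 2 ^+ m) - x (eta / 2 ^+ n))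
    (K / (2 `^ b - 1) * ((eta / 2 ^+ n) `^ b - (eta / 2 ^+ m) `^ b)).
  elim: m nm => [|m IH].
    by rewrite leqn0 => /eqP ->; rewrite !subrr mulr0; exact: nb0.
  rewrite leq_eqVlt => /orP[/eqP ->|]; first by rewrite !subrr mulr0; exact: nb0.
  rewrite ltnS => /IH {}IH.
  have e2 : eta / 2 ^+ m = 2 * (eta / 2 ^+ m.+1).
    by rewrite exprS; field; rewrite expf_neq0.
  have -> : x (eta / 2 ^+ m.+1) - x (eta / 2 ^+ n) =
    (x (eta / 2 ^+ m.+1) - x (2 * (eta / 2 ^+ m.+1))) +
      (x (eta / 2 ^+ m) - x (eta / 2 ^+ n)).
    by rewrite -e2 addrA subrK.
  have ym : 2 * (eta / 2 ^+ m.+1) <= eta.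
    rewrite -e2 ler_pdivrMr ?exprn_gt0 // ler_peMr ?(ltW eta0) //.
    by rewrite exprn_ege1 //; lra.
  apply: nb_le (nbD vpos (xd _ (y0 _) ym) IH) _.
  rewrite e2 (powRM b (ler0n _ 2) (ltW (y0 m.+1))).
  have := y0 m.+1; set y := eta / 2 ^+ m.+1 => yy.
  rewrite [leLHS](_ : _ = K / (2 `^ b - 1) * ((eta / 2 ^+ n) `^ b - y `^ b)) //.
  by field; rewrite gt_eqF.
move/nb_le; apply; rewrite ler_wpM2l // gerBl powR_ge0 //.
Qed.

(** Here [v] stands for w, [vt] for w~ and [be] for 1 - alpha, so that [Ssm] is smoothing at the
    rate t^(be - 1). All constants belong to a fixed compact interval [0, tau]; [FH] makes F Hoelder
    in time and Lipschitz in u. *)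
Context (v vt : nat -> R) (S : R -> (nat -> R) -> nat -> R) (G : (nat -> R) -> nat -> R).
Context (C be M tau U L th : R) (u F : R -> nat -> R).
Hypothesis vpos : forall n, (0 < n)%N -> 0 < v n.
Hypothesis vtpos : forall n, (0 < n)%N -> 0 < vt n.
Hypothesis vt_v : forall f B, nb vt f B -> nb v f B.
Hypothesis Ssg : sg v S.
Hypothesis C0 : 0 < C.
Hypothesis be01 : 0 < be < 1.
Hypothesis Gan : forall t f B, 0 < t <= 1 -> nb v f B ->
  isgen v S (S t f) (G (S t f)) /\ nb v (G (S t f)) (C / t * B).
Hypothesis Ssm : forall t f B, 0 < t <= 1 -> nb v f B ->
  nb vt (S t f) (C * (t `^ be / t) * B).
Hypothesis M1 : 1 <= M.
Hypothesis SM : forall t, 0 <= t <= tau -> blin v v (S t) M.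
Hypothesis U0 : 0 < U.
Hypothesis ub : forall t, 0 <= t <= tau -> nb vt (u t) U.
Hypothesis Fb : forall t, 0 <= t <= tau -> nb v (F t) U.
Hypothesis mild : forall t, 0 <= t <= tau ->
  density v 0 t (fun p q => S (t - q) (u q) - S (t - p) (u p)) (fun z => S (t - z) (F z)).
Hypothesis L0 : 0 < L.
Hypothesis th01 : 0 < th < 1.
Hypothesis FH : forall s t D, 0 <= s <= tau -> 0 <= t <= tau -> nb vt (u t - u s) D ->
  nb v (F t - F s) (L * (`|t - s| `^ th + D)).
Implicit Types (f g : nat -> R) (t s p q r h e eta : R).

Let ubv t : 0 <= t <= tau -> nb v (u t) U.
Proof. by move=> tt; exact/vt_v/ub. Qed.

Let S0 f B : nb v f B -> S 0 f = f.
Proof. by case: Ssg => _ H _ _; exact: H. Qed.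

Let SD t s f B : 0 <= t -> 0 <= s -> nb v f B -> S (t + s) f = S t (S s f).
Proof. by case: Ssg => _ _ H _; exact: H. Qed.

(** [G] is not assumed linear; linearity is inherited from the generator, whose value at a point is
    unique. *)
Lemma blin_GS eta : 0 < eta <= 1 -> blin v v (fun f => G (S eta f)) (C / eta).
Proof.
move=> eta01; split=> [c f g [A fA] [B gB]|f B fB]; last exact: (Gan eta01 fB).2.
have eta0 : 0 <= eta by lra.
have [g1 _] := Gan eta01 fA; have [g2 _] := Gan eta01 gB.
have fgB : nb v (f + c *: g) (A + `|c| * B) by apply: nbD => //; exact: nbZ.
have [g3 _] := Gan eta01 fgB.
apply: (isgen_unique vpos g3).
rewrite (sgD Ssg eta0 fA (nbZ c gB)) (sgZ Ssg c eta0 gB).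
exact: isgen_lin.
Qed.

Lemma mild_step p q : 0 <= p -> p <= q -> q <= tau ->
  nb v (u q - S (q - p) (u p)) (M * U * (q - p)).
Proof.
move=> p0 pq qt; have qt' : 0 <= q <= tau by lra.
have := density_bound vpos pq (density_sub p0 (lexx q) (mild qt')).
rewrite subrr (S0 (ubv qt')); apply=> z zpq.
have qz : 0 <= q - z <= tau by lra.
by apply: (SM qz).2; apply: Fb; lra.
Qed.

(* [u t] without the forcing on [[t - eta, t]]; it lies in the domain of [G]. *)
Definition lag eta t : nat -> R := S eta (u (t - eta)).

Lemma lag_double y t : 0 < y -> 2 * y <= 1 -> 2 * y <= t -> t <= tau ->
  exists2 D, nb v D (M * U * y) & lag y t - lag (2 * y) t = S y D.
Proof.
move=> y0 y1 yt tt; exists (u (t - y) - S y (u (t - 2 * y))).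
  have E : t - y - (t - 2 * y) = y by ring.
  by have := @mild_step (t - 2 * y) (t - y); rewrite E; apply; lra.
have yy : 0 <= y by lra.
have uy : nb v (u (t - y)) U by apply: ubv; lra.
have u2y : nb v (u (t - 2 * y)) U by apply: ubv; lra.
have [B Su2y] := sg_nb Ssg yy u2y.
rewrite (sgB Ssg yy uy Su2y) /lag -(SD yy yy u2y).
by congr (_ - S _ _); ring.
Qed.

Let Mpos : 0 < M.
Proof. exact: lt_le_trans ltr01 M1. Qed.

Local Notation K1 := (C * M * U).

Let K10 : 0 < K1.
Proof. by rewrite !mulr_gt0. Qed.

Lemma mild_lag eta t : 0 < eta <= 1 -> eta <= t -> t <= tau ->
  nb v (u t - lag eta t) (M * U * eta).
Proof.
move=> eta01 etat tt; have E : t - (t - eta) = eta by ring.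
by have := @mild_step (t - eta) t; rewrite E; apply; lra.
Qed.

Lemma half_small eta d : 0 < d -> exists n, eta / 2 ^+ n <= d.
Proof.
move=> d0; exists (Num.truncn (eta / d)).+1.
rewrite ler_pdivrMr ?exprn_gt0 // mulrC -ler_pdivrMr //.
apply/ltW/(lt_le_trans (truncnS_gt _)).
by rewrite -natrX ler_nat ltnW // ltn_expl.
Qed.

Lemma half_bounds eta n : 0 < eta -> 0 < eta / 2 ^+ n <= eta.
Proof.
move=> eta0; rewrite divr_gt0 ?exprn_gt0 //= ler_pdivrMr ?exprn_gt0 //.
by rewrite ler_peMr ?(ltW eta0) // exprn_ege1 //; lra.
Qed.

(** The dyadic lagged values are Cauchy in the norm of [vt], but their convergence to [u t] is known
    only in the norm of [v]; lower semicontinuity carries the bound across. *)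
Lemma lag_close eta t : 0 < eta <= 1 -> eta <= t -> t <= tau ->
  nb vt (u t - lag eta t) (K1 / (2 `^ be - 1) * eta `^ be).
Proof.
move=> eta01 etat tt; have [eta0 eta1] := andP eta01.
have [be0 _] := andP be01.
apply: (nb_lsc vtpos vpos) => e e0.
have MU0 : 0 < M * U by rewrite mulr_gt0.
have [n nd] := half_small eta (divr_gt0 e0 MU0).
have /andP[n0 n1] := half_bounds n eta0.
exists (lag (eta / 2 ^+ n) t - lag eta t); split.
  have := @dyadic_telescope vt (fun y => lag y t) K1 be eta vtpos (ltW K10) be0 eta0.
  move=> /(_ _ 0%N n (leq0n n)); rewrite expr0 divr1; apply=> y y0 y2.
  have [|||D DB ->] := @lag_double y t y0; [lra..|].
  have y01 : 0 < y <= 1 by lra.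
  apply: nb_le (Ssm y01 DB) _; rewrite [leLHS](_ : _ = K1 * y `^ be) //.
  by field; rewrite gt_eqF.
have -> : u t - lag eta t - (lag (eta / 2 ^+ n) t - lag eta t) = u t - lag (eta / 2 ^+ n) t.
  by rewrite opprB addrA subrK.
have n01 : 0 < eta / 2 ^+ n <= 1 by lra.
apply: nb_le (mild_lag n01 _ tt) _; first by lra.
by rewrite mulrC -ler_pdivlMr.
Qed.

Local Notation K2 := (2 * (K1 / (2 `^ be - 1)) + K1 + 4 * C ^+ 2 * M * U).

(** The increment splits into two lag errors, the forcing on a window of length eta^2 smoothed by
    [S eta], and the increment of the orbit of u(t - eta). They account for the three terms of the
    constant, in this order. *)
Lemma mild_holder eta t : 0 < eta <= 1 -> eta <= t -> t + eta ^+ 2 <= tau ->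
  nb vt (u (t + eta ^+ 2) - u t) (K2 * eta `^ be).
Proof.
move=> eta01 etat tt; have [eta0 eta1] := andP eta01.
have [be0 be1] := andP be01.
have e20 : 0 < eta ^+ 2 by rewrite exprn_gt0.
have eta0' : 0 <= eta by lra.
have hh : 0 <= eta ^+ 2 by lra.
have h2 : 0 <= eta / 2 by lra.
have h201 : 0 < eta / 2 <= 1 by lra.
pose w := u (t - eta).
have wB : nb v w U by apply: ubv; lra.
have [B1 Shw] := sg_nb Ssg hh wB.
pose f := S (eta / 2) w.
have [fG GfB] := Gan h201 wB.
have [B2 fB] := sg_nb Ssg h2 wB.
have [B3 ShfB] := sg_nb Ssg hh fB.
have be_half : (eta / 2) `^ be <= eta `^ be.
  by apply: ge0_ler_powR; rewrite ?nnegrE //; lra.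
have b1 : nb vt (S eta (u (t + eta ^+ 2 - eta) - S (eta ^+ 2) w)) (K1 * eta `^ be).
  have E : t + eta ^+ 2 - eta - (t - eta) = eta ^+ 2 by ring.
  have := @mild_step (t - eta) (t + eta ^+ 2 - eta); rewrite E => st.
  apply: nb_le (Ssm eta01 (st _ _ _)) _; [lra..|].
  rewrite [leLHS](_ : _ = K1 * eta `^ be * eta); last by field; rewrite gt_eqF.
  by rewrite ler_piMr // mulr_ge0 ?powR_ge0 // ltW.
have b2 : nb vt (S (eta / 2) (S (eta ^+ 2) f - f)) (4 * C ^+ 2 * M * U * eta `^ be).
  (* The orbit of [f] moves at speed at most M (2 C / eta) U, and half of eta is still available for
     smoothing. *)
  have inc : nb v (S (eta ^+ 2) f - f) (M * (C / (eta / 2) * U) * eta ^+ 2).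
    have := isgen_increment vpos Ssg (g' := 0) (B := M * (C / (eta / 2) * U)) fG hh.
    rewrite scaler0 subr0; apply; first by exists 0; exact: nb0.
    by move=> r rh; rewrite subr0; apply: (SM _).2 => //; lra.
  apply: nb_le (Ssm h201 inc) _.
  rewrite [leLHS](_ : _ = 4 * C ^+ 2 * M * U * (eta / 2) `^ be); last first.
    by field; rewrite gt_eqF.
  rewrite ler_wpM2l // !mulr_ge0 ?exprn_ge0 // ?ltW //; lra.
have tt1 : eta <= t + eta ^+ 2 by lra.
have tt2 : t <= tau by lra.
have c1 := lag_close eta01 tt1 tt; have c2 := lag_close eta01 etat tt2.
have -> : u (t + eta ^+ 2) - u t =
  (u (t + eta ^+ 2) - lag eta (t + eta ^+ 2)) - (u t - lag eta t) +
  (S eta (u (t + eta ^+ 2 - eta) - S (eta ^+ 2) w) + S (eta / 2) (S (eta ^+ 2) f - f)).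
  have uB : nb v (u (t + eta ^+ 2 - eta)) U by apply: ubv; lra.
  rewrite (sgB Ssg eta0' uB Shw) (sgB Ssg h2 ShfB fB) /f.
  have -> : S (eta / 2) (S (eta ^+ 2) (S (eta / 2) w)) = S eta (S (eta ^+ 2) w).
    rewrite -(SD hh h2 wB) -(SD h2 _ wB) ?addr_ge0 // -(SD eta0' hh wB).
    by congr (S _ w); field.
  rewrite -(SD h2 h2 wB) (_ : eta / 2 + eta / 2 = eta); last by field.
  by apply/funext => n; rewrite /lag !seqE; ring.
apply: nb_le (nbD vtpos (nbB vtpos c1 c2) (nbD vtpos b1 b2)) _.
lra.
Qed.

Local Notation de := (2^-1 * Num.min th be).
Local Notation K3 := (L * (1 + K2)).

Let de0 : 0 < de.
Proof.
have [th0 _] := andP th01; have [be0 _] := andP be01.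
by rewrite mulr_gt0 // ?invr_gt0 // lt_min th0.
Qed.

Let be1 : 0 < 2 `^ be - 1 :> R.
Proof.
have [be0 _] := andP be01.
have : 1 `^ be < 2 `^ be :> R by apply: gt0_ltr_powR; rewrite ?nnegrE //; lra.
by rewrite powR1 subr_gt0.
Qed.

Let K20 : 0 < K2.
Proof.
have K1p := K10; have Mp := Mpos.
rewrite !addr_gt0 // ?mulr_gt0 ?exprn_gt0 ?invr_gt0 //.
Qed.

Let K30 : 0 < K3.
Proof. by rewrite mulr_gt0 // addr_gt0. Qed.

(** [mild_holder] with eta = sqrt(t - s), whence the factor 1/2 in the exponent. The condition t - s
    <= t0^2 ensures eta <= t0 <= s, so that the lag fits before s. *)
Lemma F_holder t0 s t : 0 < t0 -> t0 <= s -> s <= t -> t <= tau ->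
  t - s <= 1 -> t - s <= t0 ^+ 2 -> nb v (F t - F s) (K3 * (t - s) `^ de).
Proof.
move=> t00 ts st tt ts1 ts2; have [th0 th1] := andP th01; have [be0 _] := andP be01.
have K3p := K30.
have [->|sNt] := eqVneq s t.
  rewrite subrr; apply: nb_le (nb0 v) _.
  by rewrite mulr_ge0 ?powR_ge0 // ltW.
have h0 : 0 < t - s by rewrite subr_gt0 lt_neqAle sNt.
pose eta := (t - s) `^ 2^-1.
have eta0 : 0 < eta by exact: powR_gt0.
have eta2 : eta ^+ 2 = t - s.
  by rewrite /eta powR12_sqrt ?sqr_sqrtr // ltW.
have eta1 : eta <= 1.
  by rewrite -(@ler_pXn2r _ 2) ?nnegrE ?(ltW eta0) // eta2 expr1n.
have etat : eta <= t0.
  by rewrite -(@ler_pXn2r _ 2) ?nnegrE ?(ltW eta0) ?(ltW t00) // eta2.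
have eta01 : 0 < eta <= 1 by rewrite eta0.
have := @mild_holder eta s eta01 (le_trans etat ts).
rewrite eta2 [s + _]addrC subrK => /(_ tt) uD.
have b1 : eta `^ be <= eta `^ Num.min th be by apply: ger_powR; rewrite // ge_min lexx orbT.
have b2 : (t - s) `^ th <= eta `^ Num.min th be.
  apply: (@le_trans _ _ (eta `^ th)); last by apply: ger_powR; rewrite // ge_min lexx.
  apply: ge0_ler_powR; rewrite ?nnegrE ?(ltW th0) ?(ltW h0) ?(ltW eta0) //.
  by rewrite -eta2 expr2 ler_piMr // ltW.
have s01 : 0 <= s <= tau by lra.
have t01 : 0 <= t <= tau by lra.
apply: nb_le (FH s01 t01 uD) _.
rewrite gtr0_norm // -[leRHS]mulrA ler_wpM2l ?(ltW L0) // [leRHS]mulrDl mul1r powRrM -/eta lerD //.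
by rewrite ler_wpM2l // ltW.
Qed.

(* Converges to [G (u t) + F t] as [eta] tends to 0.  The term [S eta (F t)] makes up,
   to leading order, for the forcing on [[t - eta, t]] that [lag eta t] lacks. *)
Definition lagW eta t : nat -> R := G (S eta (u (t - eta))) + S eta (F t).

Local Notation K4 := (M * C * K3 * 2 `^ de).

Lemma GSS y r f B : 0 < y <= 1 -> 0 <= r -> nb v f B -> G (S y (S r f)) = S r (G (S y f)).
Proof.
move=> y01 r0 fB; have y0 : 0 <= y by lra.
have [B' Srf] := sg_nb Ssg r0 fB.
have [g1 _] := Gan y01 Srf; have [g2 _] := Gan y01 fB.
apply: (isgen_unique vpos g1); rewrite -(SD y0 r0 fB) addrC (SD r0 y0 fB).
exact: isgen_sg.
Qed.

(** On the window [t - 2y, t - y] the increments of both terms of [lagW] are integrals, one of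
    [G (S y (S (q' - z) (F z)))], the other of the same expression with F(t) for F(z). Up to
    constants their difference has density at most y^de / y, on a window of length y. *)
Lemma lagW_step t0 y t : 0 < t0 -> 0 < y -> 2 * y <= 1 -> 2 * y <= t0 ^+ 2 ->
  t0 + 2 * y <= t -> t <= tau -> nb v (lagW y t - lagW (2 * y) t) (K4 * y `^ de).
Proof.
move=> t00 y0 y1 y2 yt tt; have K3p := K30; have Mp := Mpos.
pose q' := t - y; pose p' := t - 2 * y; pose f := F t; pose f1 := S y f.
have y01 : 0 < y <= 1 by lra.
have yy : 0 <= y by lra.
have C0y : 0 <= C / y by rewrite divr_ge0 // ltW.
have GS := blin_GS y01.
have q't : 0 <= q' <= tau by rewrite /q'; lra.
have p'0 : 0 <= p' by rewrite /p'; lra.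
have p'q' : p' <= q' by rewrite /p' /q'; lra.
have fB : nb v f U by apply: Fb; lra.
have Sub p : p' <= p -> p <= q' -> exists B, nb v (S (q' - p) (u p)) B.
  by move=> pp pq; apply: (sg_nb Ssg (B := U)); [lra|apply: ubv; lra].
have Jb p q : p' <= p -> p <= q -> q <= q' ->
    exists B, nb v (S (q' - q) (u q) - S (q' - p) (u p)) B.
  move=> pp pq qq; have [|B1 b1] := Sub p pp; first by lra.
  have [|B2 b2] := Sub q _ qq; first by lra.
  by exists (B2 + B1); exact: nbB.
have gb z : p' <= z <= q' -> exists B, nb v (S (q' - z) (F z)) B.
  by move=> zz; apply: (sg_nb Ssg (B := U)); [lra|apply: Fb; lra].
have D1 := density_blin GS C0y Jb gb (density_sub p'0 (lexx q') (mild q't)).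
have [fG f1B] := Gan y01 fB.
(* The orbit of [S y f] runs forward in time and the factor [S (q' - z)] backward; the reversal puts
   both on the same window. *)
have D2 := density_reverse q' (density_orbit vpos Ssg y fG).
have E1 : q' - y = p' by rewrite /p' /q'; ring.
rewrite E1 subr0 in D2.
have bnd z : p' <= z <= q' -> nb v (G (S y (S (q' - z) (F z))) - S (q' - z) (G (S y f)))
    (M * (C / y * (K3 * (2 * y) `^ de))).
  move=> zz; have r0 : 0 <= q' - z <= tau by lra.
  have [r00 _] := andP r0.
  have tz : 0 <= z <= tau by lra.
  rewrite (GSS y01 r00 (Fb tz)).
  have [_ Gz] := Gan y01 (Fb tz); have [_ Gf] := Gan y01 fB.
  rewrite -(sgB Ssg r00 Gz Gf) -(blinB GS (Fb tz) fB); apply: (SM r0).2; apply: GS.2.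
  rewrite -opprB; apply: nbN; move: zz; rewrite /p' /q' => zz.
  apply: nb_le (F_holder t00 _ _ tt _ _) _; [lra..|].
  rewrite ler_wpM2l ?(ltW K3p) //; apply: ge0_ler_powR; rewrite ?nnegrE ?(ltW de0) //; lra.
have := density_bound vpos p'q' (densityB vpos D1 D2) bnd.
have E2 : q' - p' = y by rewrite /p' /q'; ring.
rewrite E2 subrr (S0 (ubv q't)).
have up' : nb v (u p') U by apply: ubv; lra.
have [B1 Sup'] := sg_nb Ssg yy up'.
rewrite (blinB GS (ubv q't) Sup') -(SD yy yy up').
have [B2 f1B'] := sg_nb Ssg yy fB.
rewrite (S0 f1B') -(SD yy yy fB) (_ : y + y = 2 * y); last by ring.
have -> : G (S y (u q')) - G (S (2 * y) (u p')) - (S (2 * y) f - S y f) =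
   lagW y t - lagW (2 * y) t.
  by apply/funext => n; rewrite /lagW !seqE; ring.
move/nb_le; apply; rewrite (powRM _ (ler0n _ 2) yy).
by rewrite le_eqVlt; apply/orP; left; apply/eqP; field; rewrite !gt_eqF ?be1.
Qed.

Lemma half_pow_small eta b K d n : 0 < eta -> 0 < b -> 0 <= K -> 0 < d ->
  exists2 m, (n <= m)%N & K * (eta / 2 ^+ m) `^ b <= d.
Proof.
move=> eta0 b0 K0 d0; have K1p : 0 < K + 1 by lra.
have c0 : 0 < (d / (K + 1)) `^ b^-1 by rewrite powR_gt0 // divr_gt0.
have [m0 m0c] := half_small eta c0.
exists (maxn n m0); first by rewrite leq_maxl.
set m := maxn n m0.
have mm : eta / 2 ^+ m <= eta / 2 ^+ m0.
  by rewrite ler_wpM2l ?(ltW eta0) // lef_pV2 ?posrE ?exprn_gt0 // ler_weXn2l ?leq_maxr //; lra.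
have /andP[em _] := half_bounds m eta0.
have : (eta / 2 ^+ m) `^ b <= d / (K + 1).
  have -> : d / (K + 1) = ((d / (K + 1)) `^ b^-1) `^ b.
    by rewrite -powRrM mulVf ?gt_eqF // powRr1 // divr_ge0 // ltW.
  by apply: ge0_ler_powR; rewrite ?nnegrE ?(ltW b0) ?(ltW em) ?(ltW c0) // (le_trans mm).
rewrite ler_pdivlMr // mulrDr mulr1 [_ * K]mulrC; apply: le_trans.
by rewrite lerDl powR_ge0.
Qed.

Local Notation K5 := (K4 / (2 `^ de - 1)).

Let K40 : 0 <= K4.
Proof.
apply: mulr_ge0; last exact: powR_ge0.
by apply: mulr_ge0; [apply: mulr_ge0|]; apply: ltW.
Qed.

Let K50 : 0 <= K5.
Proof.
have de0' := de0.
have d1 : 0 < 2 `^ de - 1.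
  have : 1 `^ de < 2 `^ de :> R by apply: gt0_ltr_powR; rewrite ?nnegrE //; lra.
  by rewrite powR1 subr_gt0.
by apply: divr_ge0 K40 _; exact: ltW.
Qed.

(** [eta0] and the rate do not depend on t, so convergence is uniform for t >= 2 t0. As [lag eta t]
    tends to u(t) and [lagW eta t - S eta (F t)] to W - F(t), closedness puts u(t) in the domain. *)
Lemma lagW_limit t0 : 0 < t0 -> exists eta0, [/\ 0 < eta0 <= 1, eta0 <= t0 &
  forall t, 2 * t0 <= t <= tau -> exists2 W, isgen v S (u t) (W - F t) &
    forall n, nb v (W - lagW (eta0 / 2 ^+ n) t) (K5 * (eta0 / 2 ^+ n) `^ de)].
Proof.
move=> t00; pose eta0 := Num.min 1 (Num.min t0 (t0 ^+ 2)).
have t02 : 0 < t0 ^+ 2 by rewrite exprn_gt0.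
have e0 : 0 < eta0 by rewrite /eta0 !lt_min ltr01 t00.
have e1 : eta0 <= 1 by rewrite /eta0 ge_min lexx.
have et : eta0 <= t0 by rewrite /eta0 !ge_min lexx orbT.
have et2 : eta0 <= t0 ^+ 2 by rewrite /eta0 !ge_min lexx !orbT.
exists eta0; split; [by rewrite e0|by []|move=> t tt].
have tel := @dyadic_telescope v (fun y => lagW y t) K4 de eta0 vpos K40 de0 e0.
have [||W WP] := @nb_complete _ v vpos (fun n => lagW (eta0 / 2 ^+ n) t)
   (fun n => K5 * (eta0 / 2 ^+ n) `^ de).
- by move=> n m nm; apply: tel => // y y0 y2; apply: (@lagW_step t0) => //; lra.
- by move=> d n d0; exact: half_pow_small.
exists W => //; apply: (isgen_closed vpos Ssg) => e e00.
have tt' : 0 <= t <= tau by lra.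
have e20 : 0 < e / 2 by lra.
have [d d0 Sd] := sg_cont0 Ssg (Fb tt') e20.
have MU : 0 < M * U by rewrite mulr_gt0.
have c0 : 0 < Num.min (d / 2) (e / (M * U)) by rewrite lt_min !divr_gt0.
have [n0 n0P] := half_small eta0 c0.
have [n nn0 nP] := half_pow_small n0 e0 de0 K50 e20.
pose eta := eta0 / 2 ^+ n.
have /andP[n1 n2] := half_bounds n e0.
have ec : eta <= Num.min (d / 2) (e / (M * U)).
  apply: le_trans n0P; rewrite ler_wpM2l ?(ltW e0) // lef_pV2 ?posrE ?exprn_gt0 //.
  by rewrite ler_weXn2l //; lra.
have ed : eta <= d / 2 by apply: le_trans ec _; rewrite ge_min lexx.
have eM : eta <= e / (M * U) by apply: le_trans ec _; rewrite ge_min lexx orbT.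
have eta01 : 0 < eta <= 1 by rewrite /eta; lra.
have etat0 : eta <= t0 by rewrite /eta; lra.
have uB : nb v (u (t - eta)) U by apply: ubv; lra.
exists (S eta (u (t - eta))), (G (S eta (u (t - eta)))); split.
- by have [] := Gan eta01 uB.
- have etat : eta <= t by rewrite /eta; lra.
  apply: nb_le (mild_lag eta01 etat _) _; first by lra.
  by rewrite mulrC -ler_pdivlMr.
have -> : W - F t - G (S eta (u (t - eta))) = (W - lagW eta t) + (S eta (F t) - F t).
  by apply/funext => i; rewrite /lagW !seqE; ring.
have -> : e = e / 2 + e / 2 by lra.
apply: (nbD vpos); first exact: nb_le (WP n) nP.
by apply: Sd; lra.
Qed.

Hypothesis uc : ccont v 0 tau u.
Hypothesis Fc : ccont v 0 tau F.
Context (g : R -> nat -> R).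
Hypothesis ug : forall t, 0 < t <= tau -> isgen v S (u t) (g t).

(** A uniform limit of continuous functions: for fixed eta, [lagW eta] is continuous because G
    S(eta) is bounded. *)
Lemma rhs_cont t0 : 0 < t0 -> ccont v (2 * t0) tau (fun t => g t + F t).
Proof.
move=> t00 t e tt e0.
have [eta0 [eta01 etat0 lim]] := lagW_limit t00.
have [e00 e01] := andP eta01.
have e30 : 0 < e / 3 by lra.
have [n _ nP] := half_pow_small 0 e00 de0 K50 e30.
have close s : 2 * t0 <= s <= tau -> nb v (g s + F s - lagW (eta0 / 2 ^+ n) s) (e / 3).
  move=> ss; have [W Wg WP] := lim s ss.
  have -> : g s = W - F s by apply: (isgen_unique vpos (ug _)) Wg; lra.
  by rewrite subrK; apply: nb_le (WP n) nP.
have /andP[n1 n2] := half_bounds n e00.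
set eta := eta0 / 2 ^+ n in n1 n2 close.
have h01 : 0 < eta <= 1 by lra.
have GS := blin_GS h01.
have Cy : 0 < C / eta by rewrite divr_gt0.
have Mp := Mpos.
have t1 : 0 <= t - eta <= tau by lra.
have t2 : 0 <= t <= tau by lra.
have e10 : 0 < e / 6 / (C / eta) by rewrite divr_gt0 //; lra.
have e20 : 0 < e / 6 / M by rewrite divr_gt0 //; lra.
have [d1 d10 ud] := uc t1 e10.
have [d2 d20 Fd] := Fc t2 e20.
exists (Num.min d1 d2); first by rewrite lt_min d10.
move=> s ss; rewrite lt_min => /andP[sd1 sd2].
have -> : g s + F s - (g t + F t) = (g s + F s - lagW eta s) - (g t + F t - lagW eta t) +
   (lagW eta s - lagW eta t) by apply/funext => i; rewrite !seqE; ring.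
have -> : e = e / 3 + e / 3 + (e / 6 + e / 6) by lra.
apply: (nbD vpos); first by apply: (nbB vpos); apply: close.
have s1 : 0 <= s - eta <= tau by lra.
have s2 : 0 <= s <= tau by lra.
have h0 : 0 <= eta <= tau by lra.
have -> : lagW eta s - lagW eta t =
   G (S eta (u (s - eta) - u (t - eta))) + S eta (F s - F t).
  rewrite (blinB GS (ubv s1) (ubv t1)) (sgB Ssg (andP h0).1 (Fb s2) (Fb t2)).
  by apply/funext => i; rewrite /lagW !seqE; ring.
apply: (nbD vpos).
  have E : s - eta - (t - eta) = s - t by ring.
  have := ud (s - eta) s1; rewrite E => /(_ sd1)/GS.2/nb_le; apply.
  by rewrite mulrC divfK ?gt_eqF.
by apply: nb_le ((SM h0).2 _ _ (Fd s s2 sd2)) _; rewrite mulrC divfK ?gt_eqF.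
Qed.

Lemma forcing_increment p q t e : 0 <= p -> p <= q -> q <= tau -> 0 <= t <= tau ->
  (forall z, p <= z <= q -> nb v (F z - F t) e) ->
  (forall r, 0 <= r <= q - p -> nb v (S r (F t) - F t) e) ->
  nb v (u q - S (q - p) (u p) - (q - p) *: F t) ((M * e + e) * (q - p)).
Proof.
move=> p0 pq qt tt Fpq SF; have qtau : 0 <= q <= tau by lra.
have := density_bound (B := M * e + e) vpos pq
  (densityB vpos (density_sub p0 (lexx q) (mild qtau)) (density_cst v p q (F t))).
rewrite subrr (S0 (ubv qtau)); apply=> z zz.
have r0 : 0 <= q - z <= tau by lra.
have z0 : 0 <= z <= tau by lra.
have -> : S (q - z) (F z) - F t = S (q - z) (F z - F t) + (S (q - z) (F t) - F t).
  by rewrite (sgB Ssg (andP r0).1 (Fb z0) (Fb tt)) addrA subrK.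
by apply: (nbD vpos); [apply: (SM r0).2; exact: Fpq|apply: SF; lra].
Qed.

Lemma orbit_increment p q t e1 e2 : 0 < p -> p <= q -> q <= tau -> 0 < t <= tau ->
  nb v (g p - g t) e1 -> (forall r, 0 <= r <= q - p -> nb v (S r (g t) - g t) e2) ->
  nb v (S (q - p) (u p) - u p - (q - p) *: g t) ((M * e1 + e2) * (q - p)).
Proof.
move=> p0 pq qt tt gpt Sg.
have pp : 0 < p <= tau by lra.
have qp : 0 <= q - p by lra.
have [_ [Bg gB] _] := ug tt; have [_ [Bp gpB] _] := ug pp.
apply: (isgen_increment vpos Ssg (ug pp) qp); first by exists Bg.
move=> r rr; have r0 : 0 <= r <= tau by lra.
have -> : S r (g p) - g t = S r (g p - g t) + (S r (g t) - g t).
  by rewrite (sgB Ssg (andP r0).1 gpB gB) addrA subrK.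
by apply: (nbD vpos); [exact: (SM r0).2|exact: Sg].
Qed.

(** The increment is expanded at its left end [p], from which the semigroup acts, and compared with
    the value at t, where p <= t <= q; both one-sided derivatives are thus covered. Moving from [p]
    to t uses the continuity of the right-hand side. *)
Lemma mild_increment t e : 0 < t < tau -> 0 < e -> exists2 d, 0 < d & forall p q,
  p <= t -> t <= q -> p < q -> t - d < p -> q < t + d ->
  nb v (u q - u p - (q - p) *: (g t + F t)) (e * (q - p)).
Proof.
move=> tt e0.
have M2 : 0 < 3 * M + 2 by have Mp := Mpos; lra.
(* The errors are M + 1 from the forcing and 2 M + 1 from the orbit, since g = (g + F) - F is known
   only up to 2 e1. *)
pose e1 := e / (3 * M + 2).
have e10 : 0 < e1 by rewrite divr_gt0.
have t40 : 0 < t / 4 by lra.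
have t2 : 2 * (t / 4) <= t <= tau by lra.
have t1 : 0 <= t <= tau by lra.
have t3 : 0 < t <= tau by lra.
have [d1 d10 Wd] := rhs_cont t40 t2 e10.
have [d2 d20 Fd] := Fc t1 e10.
have [_ [Bg gB] _] := ug t3.
have [d3 d30 SFd] := sg_cont0 Ssg (Fb t1) e10.
have [d4 d40 Sgd] := sg_cont0 Ssg gB e10.
(* The length [q - p] may approach 2 d, hence the halves of [d3] and [d4]; t / 2 keeps [p] in the
   range of [rhs_cont]. *)
pose d := Num.min (Num.min d1 d2)
  (Num.min (Num.min (d3 / 2) (d4 / 2)) (Num.min (t / 2) (tau - t))).
have d0 : 0 < d by rewrite /d !lt_min d10 d20; lra.
have dd1 : d <= d1 by rewrite /d !ge_min lexx.
have dd2 : d <= d2 by rewrite /d !ge_min lexx !orbT.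
have dd3 : d <= d3 / 2 by rewrite /d !ge_min lexx !orbT.
have dd4 : d <= d4 / 2 by rewrite /d !ge_min lexx !orbT.
have dt : d <= t / 2 by rewrite /d !ge_min lexx !orbT.
have dtau : d <= tau - t by rewrite /d !ge_min lexx !orbT.
exists d => // p q pt tq pq tp qt.
clearbody d; clear d0 d10 d20 d30 d40 t40 M2.
have near_t s : p <= s <= q -> `|s - t| < d by rewrite ltr_norml; lra.
have p0 : 0 < p by lra.
have qtau : q <= tau by lra.
have pq' : p <= q by exact: ltW.
have pin : p <= p <= q by rewrite lexx.
have Wp : nb v (g p + F p - (g t + F t)) e1.
  by apply: Wd; [lra|exact: lt_le_trans (near_t p pin) dd1].
have Fpq z : p <= z <= q -> nb v (F z - F t) e1.
  by move=> zz; apply: Fd; [lra|exact: lt_le_trans (near_t z zz) dd2].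
have gpt : nb v (g p - g t) (e1 + e1).
  have -> : g p - g t = (g p + F p - (g t + F t)) - (F p - F t).
    by apply/funext => i; rewrite !seqE; ring.
  exact: (nbB vpos Wp (Fpq p pin)).
have SFr r : 0 <= r <= q - p -> nb v (S r (F t) - F t) e1 by move=> rr; apply: SFd; lra.
have Sgr r : 0 <= r <= q - p -> nb v (S r (g t) - g t) e1 by move=> rr; apply: Sgd; lra.
have b1 := forcing_increment (ltW p0) pq' qtau t1 Fpq SFr.
have b2 := orbit_increment p0 pq' qtau t3 gpt Sgr.
have -> : u q - u p - (q - p) *: (g t + F t) =
  (u q - S (q - p) (u p) - (q - p) *: F t) + (S (q - p) (u p) - u p - (q - p) *: g t).
  by apply/funext => i; rewrite !seqE; ring.
apply: nb_le (nbD vpos b1 b2) _; rewrite -mulrDl.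
have -> : M * e1 + e1 + (M * (e1 + e1) + e1) = e.
  by rewrite /e1; field; rewrite gt_eqF //; have Mp := Mpos; lra.
by [].
Qed.

Lemma mild_derivative t e : 0 < t < tau -> 0 < e -> exists2 d, 0 < d & forall h,
  h != 0 -> `|h| < d -> nb v (h^-1 *: (u (t + h) - u t) - (g t + F t)) e.
Proof.
move=> tt e0; have [d d0 ud] := mild_increment tt e0.
exists d => // h h0 hd.
have nh : 0 < `|h| by rewrite normr_gt0.
suff b : nb v (u (t + h) - u t - h *: (g t + F t)) (e * `|h|).
  have -> : h^-1 *: (u (t + h) - u t) - (g t + F t) =
     h^-1 *: (u (t + h) - u t - h *: (g t + F t)).
    by rewrite [RHS]scalerBr scalerA mulVf // scale1r.
  by apply: nb_le (nbZ _ b) _; rewrite normfV mulrC mulfK // gt_eqF.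
have [hp|hn] := ltP 0 h.
  have := ud t (t + h); rewrite [t + h - t]addrC addKr gtr0_norm //; apply; rewrite ?lexx //; 
  move: hd; rewrite gtr0_norm //; lra.
have {}hn : h < 0 by rewrite lt_neqAle h0.
have -> : u (t + h) - u t - h *: (g t + F t) = - (u t - u (t + h) - (t - (t + h)) *: (g t + F t)).
  by apply/funext => i; rewrite !seqE; ring.
apply: nbN; rewrite ltr0_norm // (_ : - h = t - (t + h)); last by ring.
by apply: ud => //; move: hd; rewrite ltr0_norm //; lra.
Qed.

End Parabolic.

(** * From extended-valued norms and filters to explicit bounds *)

Section Wsum.
Context {R : realType} (v : nat -> R).
Hypothesis vpos : forall n, (0 < n)%N -> 0 < v n.
Implicit Types (f g : nat -> R).

Lemma wsum_leP f (B : R) :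
  (wsum v f <= B%:E)%E <-> forall N, \sum_(1 <= n < N) v n * `|f n| <= B.
Proof.
have t0 n : (1 <= n)%N -> true -> (0 <= (v n * `|f n|)%:E)%E.
  by move=> n1 _; rewrite lee_fin mulr_ge0 // ltW // vpos.
split=> [fB N|fB].
  by rewrite -lee_fin -sumEFin; apply: le_trans fB; exact: nneseries_lim_ge.
apply: lime_le; first exact: is_cvg_nneseries.
by near=> N; rewrite sumEFin lee_fin.
Unshelve. all: by end_near. Qed.

Lemma wsum_ge0 f : (0 <= wsum v f)%E.
Proof. by apply: nneseries_ge0 => n n1 _; rewrite lee_fin mulr_ge0 // ltW // vpos. Qed.

Lemma inl1P f : inl1 v f <-> exists B, nb v f B.
Proof.
split=> [[f0 foo]|[B [f0 /wsum_leP fB]]]; last first.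
  by split=> //; apply: le_lt_trans fB _; rewrite ltry.
exists (fine (wsum v f)); split=> //; apply/wsum_leP.
by rewrite fineK // ge0_fin_numE // wsum_ge0.
Qed.

Lemma nb_wsum f B : nb v f B <-> f 0%N = 0 /\ (wsum v f <= B%:E)%E.
Proof. by split=> -[f0 /wsum_leP]. Qed.

Lemma wsum_cvg0 {T : Type} (F : set_system T) (FF : Filter F) (X : T -> nat -> R) :
  ((fun h => wsum v (X h)) @ F --> 0%E) <->
  forall e, 0 < e -> \forall h \near F, (wsum v (X h) <= e%:E)%E.
Proof.
split=> [Xc e e0|Xe].
  apply: (Xc [set x | (x <= e%:E)%E]).
  suff : nbhs (0 : R) [set r : R | (r%:E <= e%:E)%E] by [].
  apply/nbhs_ballP; exists e => //= r; rewrite /ball /= sub0r normrN lee_fin.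
  by move=> /ltW; exact: le_trans (ler_norm r).
move=> A A0; have {A0} : nbhs (0 : R) [set r : R | A r%:E] by exact: A0.
move=> /nbhs_ballP[e /= e0 eA]; have e20 : 0 < e / 2 by lra.
rewrite /nbhs /=; near=> h.
have he : (wsum v (X h) <= (e / 2)%:E)%E by near: h; exact: Xe.
have hfin : wsum v (X h) \is a fin_num.
  by rewrite ge0_fin_numE ?wsum_ge0 // (le_lt_trans he) // ltry.
rewrite /= -(fineK hfin); apply: eA; rewrite /ball /= sub0r normrN.
rewrite ger0_norm ?fine_ge0 ?wsum_ge0 //.
apply: (@le_lt_trans _ _ (e / 2)); last by lra.
by rewrite -lee_fin fineK.
Unshelve. all: by end_near. Qed.

Lemma near_right0P (P : R -> Prop) :
  (\forall h \near 0^'+, P h) <-> exists2 d, 0 < d & forall h, 0 < h < d -> P h.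
Proof.
split=> [H|[d d0 dP]].
  have : nbhs (0 : R) [set h | 0 < h -> P h] by exact: H.
  move=> /nbhs_ballP[d /= d0 dP]; exists d => // h /andP[h0 hd].
  by apply: dP => //; rewrite /ball /= sub0r normrN gtr0_norm.
suff : nbhs (0 : R) [set h | 0 < h -> P h] by [].
apply/nbhs_ballP; exists d => //= h; rewrite /ball /= sub0r normrN => hd h0.
by apply: dP; rewrite h0; rewrite gtr0_norm in hd.
Qed.

Lemma near_punctured0P (P : R -> Prop) :
  (\forall h \near 0^', P h) <-> exists2 d, 0 < d & forall h, h != 0 -> `|h| < d -> P h.
Proof.
split=> [H|[d d0 dP]].
  have : nbhs (0 : R) [set h | h != 0 -> P h] by exact: H.
  move=> /nbhs_ballP[d /= d0 dP]; exists d => // h h0 hd.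
  by apply: dP => //; rewrite /ball /= sub0r normrN.
suff : nbhs (0 : R) [set h | h != 0 -> P h] by [].
apply/nbhs_ballP; exists d => //= h; rewrite /ball /= sub0r normrN => hd h0.
exact: dP.
Qed.

Lemma near_withinP (D : set R) (t : R) (P : R -> Prop) :
  (\forall s \near within D (nbhs t), P s) <->
  exists2 d, 0 < d & forall s, D s -> `|s - t| < d -> P s.
Proof.
split=> [H|[d d0 dP]].
  have : nbhs t [set s | D s -> P s] by exact: H.
  move=> /nbhs_ballP[d /= d0 dP]; exists d => // s Ds sd.
  by apply: dP => //; rewrite /ball /= distrC.
suff : nbhs t [set s | D s -> P s] by [].
apply/nbhs_ballP; exists d => //= s; rewrite /ball /= distrC => sd Ds.
exact: dP.
Qed.

End Wsum.

(** * The generated analytic semigroup in terms of bounds *)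

Section Generation.
Context {R : realType} (v : nat -> R) (Gd : (nat -> R) -> Prop)
  (Go : (nat -> R) -> nat -> R) (S : R -> (nat -> R) -> nat -> R).
Hypothesis vpos : forall n, (0 < n)%N -> 0 < v n.
Hypothesis gen : generates v Gd Go S.
Implicit Types (f g : nat -> R).

Lemma generates_sg : sg v S.
Proof.
have [S1 [S2 [S3 [S4 [S5 [S6 _]]]]]] := gen.
have inl f B : nb v f B -> inl1 v f by move=> fB; apply/(inl1P vpos); exists B.
split=> [t t0|f B /inl/S4 //|t s f B t0 s0 /inl|f B e fB e0]; last 2 first.
- exact: S5.
- have /(wsum_cvg0 vpos)/(_ e e0)/near_right0P[d d0 dP] := S6 f (inl f B fB).
  exists d => // h hd; apply/(nb_wsum vpos); split; last exact: dP.
  have [h0 _] := andP hd.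
  by have [Sf0 _] := S1 h f (ltW h0) (inl f B fB); case: fB => f0 _; rewrite !seqE Sf0 f0 subr0.
have [M SM] := S3 t t0; exists `|M| => //; split=> [c f g [A fA] [B gB]|f B fB].
  exact: S2 t0 (inl _ _ fA) (inl _ _ gB).
have fl := inl f B fB; have [Sf0 _] := S1 t f t0 fl.
apply/(nb_wsum vpos); split=> //; apply: le_trans (SM f fl) _.
have [_ fB'] := (nb_wsum vpos f B).1 fB.
have ffin : wsum v f \is a fin_num.
  by rewrite ge0_fin_numE ?wsum_ge0 // (le_lt_trans fB') // ltry.
have f0 : 0 <= fine (wsum v f) by rewrite fine_ge0 // wsum_ge0.
have fB2 : fine (wsum v f) <= B by rewrite -lee_fin fineK.
rewrite -(fineK ffin) -EFinM lee_fin.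
by apply: le_trans (ler_wpM2r f0 (ler_norm M)) _; rewrite ler_wpM2l.
Qed.

Let quotient_isgen f g : inl1 v f -> inl1 v g ->
  ((fun h => wsum v (fun n => h^-1 * (S h f n - f n) - g n)) @ 0^'+ --> 0%E) <->
  isgen v S f g.
Proof.
move=> fl gl; have [f0 _] := fl; have [g0 _] := gl; have [S1 _] := gen.
split=> [/(wsum_cvg0 vpos) fg|[_ _ fg]].
  split; [exact/(inl1P vpos)|exact/(inl1P vpos)|move=> e e0].
  have /near_right0P[d d0 dP] := fg e e0; exists d => // h hd.
  have [h0 _] := andP hd; have [Sf0 _] := S1 h f (ltW h0) fl.
  have : nb v (fun n => h^-1 * (S h f n - f n) - g n) e.
    by apply/(nb_wsum vpos); split; [rewrite Sf0 f0 g0 !subr0 mulr0|exact: dP].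
  move=> /(nbZ h); rewrite gtr0_norm // mulrC.
  rewrite (_ : _ *: _ = S h f - f - h *: g) //.
  by apply/funext => n; rewrite !seqE; field; rewrite gt_eqF.
apply/(wsum_cvg0 vpos) => e e0; apply/near_right0P.
have [d d0 dP] := fg e e0; exists d => // h hd; have [h0 _] := andP hd.
have := nbZ h^-1 (dP h hd); rewrite gtr0_norm ?invr_gt0 // mulrC mulfK ?gt_eqF //.
rewrite (_ : _ *: _ = fun n => h^-1 * (S h f n - f n) - g n).
  by case/(nb_wsum vpos).
by apply/funext => n; rewrite !seqE; field; rewrite gt_eqF.
Qed.

Hypothesis Gd_inl1 : forall f, Gd f -> inl1 v f /\ inl1 v (Go f).

Lemma generates_isgenP f g : isgen v S f g <-> Gd f /\ g = Go f.
Proof.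
have [_ [_ [_ [_ [_ [_ [S7 S8]]]]]]] := gen.
have Gd_isgen f' : Gd f' -> isgen v S f' (Go f').
  by move=> Gf; have [fl Gl] := Gd_inl1 Gf; apply/quotient_isgen => //; exact: S8.
split=> [fg|[Gf ->]]; last exact: Gd_isgen.
have [fB gB _] := fg.
have fl : inl1 v f by apply/(inl1P vpos).
have gl : inl1 v g by apply/(inl1P vpos).
have Gf : Gd f by apply/(S7 f fl); exists g; split=> //; exact/quotient_isgen.
by split=> //; apply: isgen_unique fg _ => //; exact: Gd_isgen.
Qed.

Lemma analytic_nb : analytic_sg v Gd Go S -> exists2 C, 0 < C & forall t f B,
  0 < t <= 1 -> nb v f B ->
  isgen v S (S t f) (Go (S t f)) /\ nb v (Go (S t f)) (C / t * B).
Proof.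
move=> [SG [C SC]]; exists (`|C| + 1); first by rewrite ltr_wpDl.
move=> t f B t01 fB; have [t0 t1] := andP t01.
have fl : inl1 v f by apply/(inl1P vpos); exists B.
have GS := SG t f t0 fl; split; first exact/generates_isgenP.
have [_ [G0 _]] := Gd_inl1 GS.
apply/(nb_wsum vpos); split=> //; apply: le_trans (SC t f t01 fl) _.
have [_ fB'] := (nb_wsum vpos f B).1 fB.
have ffin : wsum v f \is a fin_num.
  by rewrite ge0_fin_numE ?wsum_ge0 // (le_lt_trans fB') // ltry.
have f0 : 0 <= fine (wsum v f) by rewrite fine_ge0 // wsum_ge0.
have fB2 : fine (wsum v f) <= B by rewrite -lee_fin fineK.
have Ct : C / t <= (`|C| + 1) / t.
  by rewrite ler_pM2r ?invr_gt0 // (le_trans (ler_norm C)) // lerDl.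
rewrite -(fineK ffin) -EFinM lee_fin.
apply: le_trans (ler_wpM2r f0 Ct) _; rewrite ler_wpM2l // divr_ge0 ?(ltW t0) //.
Qed.

End Generation.

(** * Fragmentation: relative bound of B and interpolation *)

Section Fragmentation.
Context {R : realType} (a w : nat -> R) (b : nat -> nat -> R) (kappa alpha : R).
Hypothesis wpos : forall n, (0 < n)%N -> 0 < w n.
Hypothesis a0 : forall n, (0 < n)%N -> 0 <= a n.
Hypothesis b0 : forall n j, (0 < n)%N -> (0 < j)%N -> 0 <= b n j.
Hypothesis b_upper : forall n j, (0 < n)%N -> (j <= n)%N -> b n j = 0.
Hypothesis kappa01 : 0 < kappa < 1.
Hypothesis b_sum : forall j, (2 <= j)%N -> \sum_(1 <= n < j) w n * b n j <= kappa * w j.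
Hypothesis alpha01 : 0 < alpha < 1.
Implicit Types (f g : nat -> R).

(** Column j vanishes from row j on, so cutting at N instead of j only drops nonnegative terms or
    adds zeros. *)
Lemma b_sum_trunc N j : (0 < j)%N -> \sum_(1 <= n < N) w n * b n j <= kappa * w j.
Proof.
move=> j0; have [k0 k1] := andP kappa01.
have full : \sum_(1 <= n < j) w n * b n j <= kappa * w j.
  have [j2|j1] := leqP 2 j; first exact: b_sum.
  by rewrite big_geq // mulr_ge0 ?ltW ?wpos.
have t0 n : (0 < n)%N -> 0 <= w n * b n j.
  by move=> n0; rewrite mulr_ge0 ?b0 // ltW ?wpos.
apply: le_trans full; have [Nj|jN] := leqP N j.
  have [->|N0] := posnP N.
    by rewrite big_geq // big_nat_cond sumr_ge0 // => i /andP[/andP[/t0]].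
  rewrite (@big_cat_nat _ _ _ N 1 j) //= lerDl big_nat_cond sumr_ge0 // => i.
  by move=> /andP[/andP[Ni _] _]; apply: t0; exact: leq_trans Ni.
rewrite (@big_cat_nat _ _ _ j 1 N) ?(ltnW jN) //= [X in _ + X]big_nat_cond.
rewrite [X in _ + X]big1 ?addr0 // => i /andP[/andP[ji _] _].
by rewrite b_upper ?mulr0 //; exact: leq_trans ji.
Qed.

(** Column sums: w_n b_{n,j} summed over n is at most kappa w_j. The summations are exchanged for
    the truncations [p M], and M tends to infinity afterwards in finitely many coordinates. *)
Lemma nb_Bop f X : (forall n, (0 < n)%N -> rseries_cvg n.+1 (fun j => a j * b n j * f j)) ->
  nb w (Aop a f) X -> nb w (Bop a b f) (kappa * X).
Proof.
move=> fc [_ fX]; have [k0 k1] := andP kappa01; split=> // N.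
pose p M n := \sum_(n.+1 <= j < M) a j * b n j * f j.
have pc n : (0 < n)%N -> (fun M => p M n) @ \oo --> Bop a b f n.
  by move=> n0; have /cvg_ex[l lc] := fc n n0; case: n n0 lc => // n _ lc;
     rewrite /Bop /rseries (cvg_lim _ lc).
have sc : (fun M => \sum_(1 <= n < N) w n * `|p M n|) @ \oo -->
          \sum_(1 <= n < N) w n * `|Bop a b f n|.
  elim: N => [|N IH].
    under eq_fun do rewrite big_geq //; rewrite big_geq //; exact: cvg_cst.
  have [->|N0] := posnP N.
    under eq_fun do rewrite big_geq //; rewrite big_geq //; exact: cvg_cst.
  under eq_fun do rewrite big_nat_recr //=; rewrite big_nat_recr //=.
  by apply: cvgD IH _; apply: cvgMl_tmp; apply: cvg_norm; exact: pc.
rewrite -(cvg_lim _ sc) //; apply: limr_le; first by apply/cvg_ex; eexists; exact: sc.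
near=> M; have := fX M; rewrite -(ler_pM2l k0); apply: le_trans.
apply: (@le_trans _ _ (\sum_(1 <= n < N) \sum_(1 <= j < M) w n * b n j * (a j * `|f j|))).
  apply: ler_sum_nat => n /andP[n1 nN].
  under [leRHS]eq_bigr do rewrite -mulrA.
  rewrite -mulr_sumr ler_wpM2l ?(ltW (wpos n1)) //.
  apply: le_trans (ler_norm_sum _ _ _) _.
  have t0 j : (0 < j)%N -> 0 <= b n j * (a j * `|f j|).
    by move=> j0; rewrite !mulr_ge0 ?b0 ?a0.
  have [nM|Mn] := leqP n.+1 M; last first.
    rewrite big_geq; last exact: ltnW.
    by rewrite big_nat_cond sumr_ge0 // => j /andP[/andP[/t0]].
  rewrite [leRHS](@big_cat_nat _ _ _ n.+1) //=.
  apply: ler_wpDl.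
    by rewrite big_nat_cond sumr_ge0 // => j /andP[/andP[/t0]].
  rewrite big_nat_cond [leRHS]big_nat_cond; apply: ler_sum => j /andP[/andP[nj _] _].
  have j1 : (0 < j)%N by exact: leq_trans nj.
  by rewrite !normrM (ger0_norm (a0 j1)) (ger0_norm (b0 n1 j1)) mulrAC mulrC.
rewrite exchange_big /= mulr_sumr; apply: ler_sum_nat => j /andP[j1 _].
rewrite -mulr_suml; have -> : `|Aop a f j| = a j * `|f j|.
  by case: j j1 => // j j1; rewrite /Aop normrN normrM ger0_norm ?a0.
by rewrite [leRHS]mulrA ler_wpM2r ?mulr_ge0 ?a0 // b_sum_trunc.
Unshelve. all: by end_near. Qed.

Lemma Gdom_inl1 f : Gdom w a b f -> inl1 w f /\ inl1 w (Gop a b f).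
Proof.
move=> [[fl /(inl1P wpos)[A AB]] [_ [_ /(inl1P wpos)[B BB]]]]; split=> //.
by apply/(inl1P wpos); exists (A + B); exact: (nbD wpos AB BB).
Qed.

(** As A f = G f - B f, the norm X of A f is at most the norm of G f plus kappa X. Absorbing the
    last term requires X to be finite, which membership in the domain provides. *)
Lemma nb_Aop_le f B : Gdom w a b f -> nb w (Gop a b f) B ->
  nb w (Aop a f) (B / (1 - kappa)).
Proof.
move=> [[_ /(inl1P wpos)[A AB]] [_ [fc _]]] GB; have [k0 k1] := andP kappa01.
have [X AX Xmin] := nb_min AB.
have : nb w (Aop a f) (B + kappa * X).
  have -> : Aop a f = Gop a b f - Bop a b f.
    by apply/funext => n; rewrite !seqE /Gop; ring.
  exact: (nbB wpos GB (nb_Bop fc AX)).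
move=> /Xmin XB; apply: nb_le AX _; rewrite ler_pdivlMr; last by lra.
lra.
Qed.

(** The inequality z^alpha <= 1 + z at z = x t, divided by t^alpha. The scale t will be the time,
    which balances the two terms for x of order 1/t. *)
Lemma powR_interp (x t : R) : 0 <= x -> 0 < t <= 1 ->
  x `^ alpha <= t `^ (1 - alpha) * x + t `^ (1 - alpha) / t.
Proof.
move=> x0 /andP[t0 t1]; have [al0 al1] := andP alpha01.
have z1 z : 0 <= z -> z `^ alpha <= 1 + z.
  move=> z0; have [zle|zge] := leP z 1.
    have : z `^ alpha <= 1 `^ alpha by apply: ge0_ler_powR; rewrite ?nnegrE //; lra.
    by rewrite powR1; lra.
  have : z `^ alpha <= z by apply: ler1_powR; lra.
  lra.
have := z1 (x * t) (mulr_ge0 x0 (ltW t0)); rewrite (powRM _ x0 (ltW t0)).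
have ta : 0 < t `^ alpha by exact: powR_gt0.
have -> : t `^ (1 - alpha) = t / t `^ alpha.
  by rewrite powRB ?gt_eqF ?implybT // powRr1 // ltW.
rewrite -ler_pdivlMr //; move/le_trans; apply.
by rewrite le_eqVlt; apply/orP; left; apply/eqP; field; rewrite !gt_eqF.
Qed.

Lemma wtilde_gt0 n : (0 < n)%N -> 0 < wtilde alpha a w n.
Proof. by move=> n0; rewrite mulr_gt0 ?wpos // powR_gt0 // ltr_wpDr ?a0. Qed.

Lemma nb_wtilde_w f B : nb (wtilde alpha a w) f B -> nb w f B.
Proof.
move=> [f0 fB]; split=> // N; apply: le_trans (fB N).
have [al0 al1] := andP alpha01.
apply: ler_sum_nat => n /andP[n1 _]; rewrite ler_wpM2r // /wtilde.
rewrite ler_peMl ?(ltW (wpos n1)) //.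
have : 1 `^ alpha <= (1 + a n) `^ alpha.
  by have an := a0 n1; apply: ge0_ler_powR; rewrite ?nnegrE; lra.
by rewrite powR1.
Qed.

Lemma nb_wtilde_interp f A D t : 0 < t <= 1 -> nb w f A -> nb w (Aop a f) D ->
  nb (wtilde alpha a w) f (t `^ (1 - alpha) * (A + D) + t `^ (1 - alpha) / t * A).
Proof.
move=> t01 [f0 fA] [_ fD]; have [t0 t1] := andP t01; split=> // N.
have be0 : 0 <= t `^ (1 - alpha) by exact: powR_ge0.
have bt0 : 0 <= t `^ (1 - alpha) / t by rewrite divr_ge0 // ltW.
apply: le_trans (lerD (ler_wpM2l be0 (lerD (fA N) (fD N))) (ler_wpM2l bt0 (fA N))).
rewrite -big_split /= !mulr_sumr -big_split /=.
apply: ler_sum_nat => n /andP[n1 _].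
have -> : `|Aop a f n| = a n * `|f n|.
  by case: n n1 => // n n1; rewrite /Aop normrN normrM ger0_norm ?a0.
have an : 0 <= 1 + a n by rewrite addr_ge0 ?a0.
have wf : 0 <= w n * `|f n| by rewrite mulr_ge0 // ltW ?wpos.
move: (ler_wpM2r wf (powR_interp an t01)).
by move=> ineq; rewrite /wtilde -[leLHS]mulrA; apply: le_trans ineq _; lra.
Qed.

End Fragmentation.

(** * Absolutely convergent series and convolutions *)

Section AbsoluteSeries.
Context {R : realType}.

Lemma rseries_abs (x : nat -> R) B : (forall N, \sum_(1 <= i < N) `|x i| <= B) ->
  rseries_cvg 1 x /\ `|rseries 1 x| <= B.
Proof.
move=> xB; pose x' i := if i is 0%N then 0 else x i.
have E (h : R -> R) N : h 0 = 0 -> \sum_(1 <= i < N) h (x i) = \sum_(0 <= i < N) h (x' i).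
  move=> h0; case: N => [|N]; first by rewrite !big_geq.
  by rewrite [RHS]big_ltn //= h0 add0r; apply: eq_big_nat => -[].
have xc : rseries_cvg 1 x.
  rewrite /rseries_cvg; under eq_fun do rewrite (E id) //.
  apply: normed_cvg; apply: nondecreasing_is_cvgn.
    by apply: nondecreasing_series => n _ _; exact: normr_ge0.
  by exists B => _ [N _ <-]; have := xB N; rewrite (E Num.norm) ?normr0.
split=> //; rewrite /rseries -lim_norm //; apply: limr_le; first exact: is_cvg_norm.
by near=> N; apply: le_trans (xB N); exact: ler_norm_sum.
Unshelve. all: by end_near. Qed.

Lemma rseriesD m (x y : nat -> R) : rseries_cvg m x -> rseries_cvg m y ->
  rseries m (fun j => x j + y j) = rseries m x + rseries m y.
Proof.
move=> xc yc; rewrite /rseries; under eq_fun do rewrite big_split /=.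
exact: limD.
Qed.

(** With i = n - j, the pairs (i, j) form a triangle inside the square of all pairs below N. *)
Lemma sum_convolution_le (F H : nat -> R) N :
  (forall n, (0 < n)%N -> 0 <= F n) -> (forall n, (0 < n)%N -> 0 <= H n) ->
  \sum_(1 <= n < N) \sum_(1 <= j < n) F (n - j)%N * H j <=
  (\sum_(1 <= n < N) F n) * (\sum_(1 <= n < N) H n).
Proof.
move=> F0 H0.
have sF M : 0 <= \sum_(1 <= n < M) F n.
  by rewrite big_nat_cond sumr_ge0 // => i /andP[/andP[/F0]].
have shift j M : (0 < j)%N ->
    \sum_(1 <= n < M) (if (j < n)%N then F (n - j)%N else 0) = \sum_(1 <= i < M - j) F i.
  move=> j0; elim: M => [|M IH]; first by rewrite !big_geq.
  have [->|M0] := posnP M; first by rewrite !big_geq // leq_subr.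
  rewrite big_nat_recr //= IH; have [jM|Mj] := ltnP j M.
    by rewrite subSn ?(ltnW jM) // big_nat_recr //= subn_gt0.
  by rewrite addr0 !big_geq //; rewrite leq_subLR addn1 // leqW.
rewrite (@eq_big_nat _ _ _ _ _ _ (fun n =>
    \sum_(1 <= j < N) (if (j < n)%N then F (n - j)%N else 0) * H j)); last first.
  move=> n /andP[n1 nN]; rewrite (big_nat_widen _ _ N) ?(ltnW nN) // big_mkcond /=.
  by apply: eq_bigr => j _; case: ifP => //; rewrite mul0r.
rewrite exchange_big /= mulr_sumr; apply: ler_sum_nat => j /andP[j1 _].
rewrite -mulr_suml ler_wpM2r ?H0 // shift //.
have [Nj|Nj] := leqP (N - j) 1; first by rewrite (@big_geq _ _ _ 1 (N - j)) //; exact: sF.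
have Nj0 := ltnW Nj; rewrite [leRHS](@big_cat_nat _ _ _ (N - j)) ?leq_subr //=.
rewrite lerDl big_nat_cond sumr_ge0 // => i /andP[/andP[ji _] _].
by apply: F0; apply: leq_trans ji; exact: ltnW.
Qed.

End AbsoluteSeries.

(** * The coagulation operator from l^1_{w~} to l^1_w *)

Section Coagulation.
Context {R : realType} (w wt : nat -> R).
Hypothesis wpos : forall n, (0 < n)%N -> 0 < w n.
Hypothesis wmono : forall n m, (0 < n)%N -> (n <= m)%N -> w n <= w m.
Hypothesis wtpos : forall n, (0 < n)%N -> 0 < wt n.
Implicit Types (f g : nat -> R) (K : nat -> nat -> R).

(** The absolute value allows for differences of kernels at two times. *)
Definition kernel_le K (c : R) := forall n j, (0 < n)%N -> (0 < j)%N ->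
  `|K n j| <= c * (wt n * wt j / w (n + j)%N).

(** The bilinear map whose diagonal [coag K f f], for K = k(t), is [Kop]. *)
Definition coag K f g : nat -> R := fun n => if n is 0%N then 0 else
  2^-1 * (\sum_(1 <= j < n) K (n - j)%N j * f (n - j)%N * g j)
  - rseries 1 (fun j => K n j * f n * g j).

(** Monotonicity of [w] lets the denominator w_{n+j} be lowered to w_n, which no longer involves the
    summation index. *)
Lemma loss_term K c f g A B n : 0 <= c -> kernel_le K c -> nb wt f A -> nb wt g B ->
  (0 < n)%N -> forall N,
  \sum_(1 <= j < N) `|K n j * f n * g j| <= c * (wt n * `|f n|) * B / w n.
Proof.
move=> c0 Kc fA [_ gB] n0 N; have := gB N => /(ler_wpM2l _) H.
have k0 : 0 <= c * (wt n * `|f n|) / w n.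
  by rewrite !mulr_ge0 ?invr_ge0 ?(ltW (wpos _)) ?(ltW (wtpos _)).
rewrite mulrAC; apply: le_trans (H _ k0); rewrite mulr_sumr.
apply: ler_sum_nat => j /andP[j1 _]; rewrite !normrM.
have nj : (0 < n + j)%N by rewrite addn_gt0 n0.
have b1 : `|K n j| <= c * (wt n * wt j / w n).
  apply: le_trans (Kc n j n0 j1) _; rewrite ler_wpM2l // ler_wpM2l //.
    by rewrite mulr_ge0 // ltW ?wtpos.
  by rewrite lef_pV2 ?posrE ?wpos // wmono // leq_addr.
apply: le_trans (ler_wpM2r _ (ler_wpM2r _ b1)) _ => //.
by rewrite le_eqVlt; apply/orP; left; apply/eqP; field; rewrite gt_eqF ?wpos.
Qed.

Lemma loss_cvg K c f g A B n : 0 <= c -> kernel_le K c -> nb wt f A -> nb wt g B ->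
  (0 < n)%N -> rseries_cvg 1 (fun j => K n j * f n * g j).
Proof.
by move=> c0 Kc fA gB n0; have [] := rseries_abs (loss_term c0 Kc fA gB n0).
Qed.

(** In the gain term w_n cancels the denominator w_{(n-j)+j}, leaving a convolution. Gain and loss
    contribute at most c A B each. *)
Lemma nb_coag K c f g A B : 0 <= c -> kernel_le K c -> nb wt f A -> nb wt g B ->
  nb w (coag K f g) (2 * c * A * B).
Proof.
move=> c0 Kc fA gB; have [A0 B0] := (nb_ge0 fA, nb_ge0 gB).
have cAB : 0 <= c * A * B by rewrite !mulr_ge0.
split=> // N.
pose gain n := \sum_(1 <= j < n) K (n - j)%N j * f (n - j)%N * g j.
pose loss n := rseries 1 (fun j => K n j * f n * g j).
have Fp n : (0 < n)%N -> 0 <= wt n * `|f n| by move=> n0; rewrite mulr_ge0 // ltW ?wtpos.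
have Gp n : (0 < n)%N -> 0 <= wt n * `|g n| by move=> n0; rewrite mulr_ge0 // ltW ?wtpos.
have gainB : \sum_(1 <= n < N) w n * `|gain n| <= c * A * B.
  apply: (@le_trans _ _ (c * \sum_(1 <= n < N) \sum_(1 <= j < n)
      (wt (n - j)%N * `|f (n - j)%N|) * (wt j * `|g j|))).
    rewrite mulr_sumr; apply: ler_sum_nat => n /andP[n1 _].
    apply: le_trans (ler_wpM2l (ltW (wpos n1)) (ler_norm_sum _ _ _)) _.
    rewrite !mulr_sumr; apply: ler_sum_nat => j /andP[j1 jn].
    have nj : (0 < n - j)%N by rewrite subn_gt0.
    rewrite !normrM; have := Kc _ _ nj j1; rewrite subnK ?(ltnW jn) // => b1.
    apply: le_trans (ler_wpM2l (ltW (wpos n1)) (ler_wpM2r _ (ler_wpM2r _ b1))) _ => //.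
    by rewrite le_eqVlt; apply/orP; left; apply/eqP; field; rewrite gt_eqF ?wpos.
  rewrite -mulrA ler_wpM2l //; apply: le_trans (sum_convolution_le N Fp Gp) _.
  apply: ler_pM; [| |exact: fA.2|exact: gB.2].
  - by rewrite big_nat_cond sumr_ge0 // => i /andP[/andP[/Fp]].
  - by rewrite big_nat_cond sumr_ge0 // => i /andP[/andP[/Gp]].
have lossB : \sum_(1 <= n < N) w n * `|loss n| <= c * A * B.
  apply: (@le_trans _ _ (c * B * \sum_(1 <= n < N) wt n * `|f n|)).
    rewrite mulr_sumr; apply: ler_sum_nat => n /andP[n1 _].
    have [_ lb] := rseries_abs (loss_term c0 Kc fA gB n1).
    apply: le_trans (ler_wpM2l (ltW (wpos n1)) lb) _.
    by rewrite le_eqVlt; apply/orP; left; apply/eqP; field; rewrite gt_eqF ?wpos.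
  by rewrite mulrAC ler_wpM2r // ler_wpM2l //; exact: fA.2.
have -> : 2 * c * A * B = c * A * B + c * A * B by ring.
apply: le_trans (lerD gainB lossB); rewrite -big_split /=.
apply: ler_sum_nat => n /andP[n1 _]; rewrite -mulrDr ler_wpM2l ?(ltW (wpos n1)) //.
have -> : coag K f g n = 2^-1 * gain n - loss n by case: n n1.
apply: le_trans (ler_normB _ _) _; rewrite lerD2r normrM.
have := normr_ge0 (gain n); rewrite ger0_norm ?invr_ge0 //; lra.
Qed.

(** K(f, f) - K'(g, g) = (K - K')(f, f) + K'(f - g, f) + K'(g, f - g); the loss series can be split
    because each part converges. *)
Lemma coag_diff K K' c c' f g A D : 0 <= c -> 0 <= c' -> kernel_le K c -> kernel_le K' c ->
  kernel_le (fun n j => K n j - K' n j) c' ->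
  nb wt f A -> nb wt g A -> nb wt (f - g) D ->
  nb w (coag K f f - coag K' g g) (2 * c' * A * A + 4 * c * A * D).
Proof.
move=> c0 c'0 Kc Kc' KK' fA gA fgD.
have -> : coag K f f - coag K' g g = coag (fun n j => K n j - K' n j) f f +
    (coag K' (f - g) f + coag K' g (f - g)).
  apply/funext => -[|n]; rewrite !seqE /=; first by rewrite !addr0 subr0.
  have n0 : (0 < n.+1)%N by [].
  have l1 := loss_cvg c'0 KK' fA fA n0.
  have l2 := loss_cvg c0 Kc' fgD fA n0.
  have l3 := loss_cvg c0 Kc' gA fgD n0.
  have l4 := loss_cvg c0 Kc' gA gA n0.
  have l23 : rseries_cvg 1 (fun j => K' n.+1 j * (f - g) n.+1 * f j +
      K' n.+1 j * g n.+1 * (f - g) j).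
    by rewrite /rseries_cvg; under eq_fun do rewrite big_split /=; exact: is_cvgD.
  have l123 : rseries_cvg 1 (fun j => (K n.+1 j - K' n.+1 j) * f n.+1 * f j +
     (K' n.+1 j * (f - g) n.+1 * f j + K' n.+1 j * g n.+1 * (f - g) j)).
    by rewrite /rseries_cvg; under eq_fun do rewrite big_split /=; exact: is_cvgD.
  have E : rseries 1 (fun j => K n.+1 j * f n.+1 * f j) =
    rseries 1 (fun j => (K n.+1 j - K' n.+1 j) * f n.+1 * f j) +
    (rseries 1 (fun j => K' n.+1 j * (f - g) n.+1 * f j) +
     rseries 1 (fun j => K' n.+1 j * g n.+1 * (f - g) j)) +
    rseries 1 (fun j => K' n.+1 j * g n.+1 * g j).
    rewrite -(rseriesD l2 l3) -(rseriesD l1 l23) -(rseriesD l123 l4); congr (rseries 1 _).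
    by apply/funext => j; rewrite !seqE; ring.
  rewrite E.
  have -> : \sum_(1 <= j < n.+1) K (n.+1 - j)%N j * f (n.+1 - j)%N * f j =
    \sum_(1 <= j < n.+1) (K (n.+1 - j)%N j - K' (n.+1 - j)%N j) * f (n.+1 - j)%N * f j +
    (\sum_(1 <= j < n.+1) K' (n.+1 - j)%N j * (f - g) (n.+1 - j)%N * f j +
     \sum_(1 <= j < n.+1) K' (n.+1 - j)%N j * g (n.+1 - j)%N * (f - g) j) +
    \sum_(1 <= j < n.+1) K' (n.+1 - j)%N j * g (n.+1 - j)%N * g j.
    by rewrite -!big_split /=; apply: eq_bigr => j _; rewrite !seqE; ring.
  ring.
apply: nb_le (nbD wpos (nb_coag c'0 KK' fA fA)
  (nbD wpos (nb_coag c0 Kc' fgD fA) (nb_coag c0 Kc' gA fgD))) _.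
by rewrite le_eqVlt; apply/orP; left; apply/eqP; ring.
Qed.

End Coagulation.

(** * The coagulation-fragmentation equation on compact time intervals *)

Section CoagulationFragmentation.
Context {R : realType} (T t1 : \bar R) (a w : nat -> R) (b : nat -> nat -> R)
  (k : nat -> nat -> R -> R) (kappa alpha : R)
  (S : R -> (nat -> R) -> nat -> R) (u0 : nat -> R) (u : R -> nat -> R).
Hypothesis a0 : forall n, (0 < n)%N -> 0 <= a n.
Hypothesis b0 : forall n j, (0 < n)%N -> (0 < j)%N -> 0 <= b n j.
Hypothesis b_upper : forall n j, (0 < n)%N -> (j <= n)%N -> b n j = 0.
Hypothesis k0 : forall n j, (0 < n)%N -> (0 < j)%N -> forall t, Ico0 T t -> 0 <= k n j t.
Hypothesis wn : forall n, (0 < n)%N -> n%:R <= w n.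
Hypothesis wmono : forall n m, (0 < n)%N -> (n <= m)%N -> w n <= w m.
Hypothesis kappa01 : 0 < kappa < 1.
Hypothesis b_sum : forall j, (2 <= j)%N -> \sum_(1 <= n < j) w n * b n j <= kappa * w j.
Hypothesis alpha01 : 0 < alpha < 1.
Local Notation wt := (wtilde alpha a w).
Hypothesis kc : forall t', 0 < t' -> (t'%:E < T)%E -> exists c : R, 0 < c /\
  forall n j t, (0 < n)%N -> (0 < j)%N -> 0 <= t <= t' ->
    k n j t <= c * wt n * wt j / w (n + j)%N.
Hypothesis kholder : forall t', 0 < t' -> (t'%:E < T)%E -> exists (ct theta : R),
  0 < ct /\ 0 < theta < 1 /\
  forall n j s t, (0 < n)%N -> (0 < j)%N -> 0 <= s <= t' -> 0 <= t <= t' ->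
    `|k n j t - k n j s| <= ct * (wt n * wt j / w (n + j)%N) * (`|t - s| `^ theta).
Hypothesis gen : generates w (Gdom w a b) (Gop a b) S.
Hypothesis analytic : analytic_sg w (Gdom w a b) (Gop a b) S.
Hypothesis u0l : inl1 wt u0.
Hypothesis t1T : (t1 <= T)%E.
Hypothesis mild : mild_sol w wt S k u0 t1 u.

Let wpos n : (0 < n)%N -> 0 < w n.
Proof. by move=> n0; apply: lt_le_trans (wn n0); rewrite ltr0n. Qed.

Let wtpos n : (0 < n)%N -> 0 < wt n.
Proof. exact: wtilde_gt0. Qed.

Let wt_w f B : nb wt f B -> nb w f B.
Proof. exact: nb_wtilde_w. Qed.

Let Ssg : sg w S.
Proof. exact: generates_sg wpos gen. Qed.

Let isgenP f g : isgen w S f g <-> Gdom w a b f /\ g = Gop a b f.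
Proof. by apply: (generates_isgenP wpos gen) => f' Gf; exact: Gdom_inl1 wpos f' Gf. Qed.

(** Interpolation at scale t between a bound M for S(t) and a bound C / (1 - kappa) / t for A S(t):
    as t <= 1, both contributions are at most multiples of t^(-alpha). *)
Lemma smoothing : exists2 C, 0 < C &
  (forall t f B, 0 < t <= 1 -> nb w f B ->
     isgen w S (S t f) (Gop a b (S t f)) /\ nb w (Gop a b (S t f)) (C / t * B)) /\
  (forall t f B, 0 < t <= 1 -> nb w f B ->
     nb wt (S t f) (C * (t `^ (1 - alpha) / t) * B)).
Proof.
have [k00 k1] := andP kappa01.
have Gl f : Gdom w a b f -> inl1 w f /\ inl1 w (Gop a b f) by exact: Gdom_inl1.
have [C C0 SC] := analytic_nb wpos gen Gl analytic.
have [M M1 SM] := sg_bound wpos Ssg 1.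
have K0 : 0 < 1 - kappa by lra.
have CK : 0 < C / (1 - kappa) by rewrite divr_gt0.
exists (C + (2 * M + C / (1 - kappa))); first by lra.
split=> t f B t01 fB; have [t0 tle1] := andP t01; have B0 := nb_ge0 fB.
  have [fg GB] := SC t f B t01 fB; split=> //; apply: nb_le GB _.
  by rewrite ler_wpM2r // ler_pM2r ?invr_gt0 //; lra.
have [fg GB] := SC t f B t01 fB.
have [Gd _] := (isgenP _ _).1 fg.
have AB := nb_Aop_le wpos a0 b0 b_upper kappa01 b_sum Gd GB.
have SB : nb w (S t f) (M * B) by apply: (SM t _).2 => //; rewrite (ltW t0).
apply: nb_le (nb_wtilde_interp wpos a0 alpha01 t01 SB AB) _.
have p0 : 0 <= t `^ (1 - alpha) by exact: powR_ge0.
set p := t `^ (1 - alpha) in p0 *.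
have pt0 : 0 <= p / t by rewrite divr_ge0 // ltW.
have ppt : p <= p / t by rewrite ler_peMr // invf_ge1.
have pB : p * (M * B) <= p / t * (M * B) by rewrite ler_wpM2r // mulr_ge0 //; lra.
have CB : 0 <= C * (p / t) * B := mulr_ge0 (mulr_ge0 (ltW C0) pt0) B0.
rewrite mulrDr (_ : p * (C / t * B / (1 - kappa)) = C / (1 - kappa) * (p / t) * B); last first.
  by field; rewrite !gt_eqF.
lra.
Qed.

Let Ico tau t : (tau%:E < t1)%E -> 0 <= t <= tau -> Ico0 t1 t.
Proof.
move=> tau1 /andP[t0 tt]; split=> //.
by apply: le_lt_trans tau1; rewrite lee_fin.
Qed.

Lemma local_estimates tau : 0 < tau -> (tau%:E < t1)%E -> exists U L th,
  [/\ 0 < U, 0 < L & 0 < th < 1] /\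
  [/\ ccont wt 0 tau u,
      (forall t, 0 <= t <= tau -> nb wt (u t) U),
      (forall t, 0 <= t <= tau -> nb w (Kop k t (u t)) U) &
      (forall s t D, 0 <= s <= tau -> 0 <= t <= tau -> nb wt (u t - u s) D ->
         nb w (Kop k t (u t) - Kop k s (u s)) (L * (`|t - s| `^ th + D)))].
Proof.
move=> tau0 tau1; have tauT := lt_le_trans tau1 t1T.
have [ul uc _] := mild.
have [c [c0 cP]] := kc tau0 tauT.
have [ct [th [ct0 [th01 ctP]]]] := kholder tau0 tauT.
have ub t : 0 <= t <= tau -> exists B, nb wt (u t) B.
  by move=> /(Ico tau1)/ul/(inl1P wtpos).
have ucc : ccont wt 0 tau u.
  move=> z e zt e0.
  have /(wsum_cvg0 wtpos)/(_ e e0)/near_withinP[d d0 dP] := uc z (Ico tau1 zt).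
  exists d => // s st sz; apply/(nb_wsum wtpos); split; last exact: dP (Ico tau1 st) sz.
  by rewrite !seqE (ul s (Ico tau1 st)).1 (ul z (Ico tau1 zt)).1 subrr.
have [U1 U10 uU] := ccont_bounded wtpos (ltW tau0) ub ucc.
have kle t : 0 <= t <= tau -> kernel_le w wt (fun n j => k n j t) c.
  move=> tt n j n0 j0; have TI : Ico0 T t.
    by have [? ?] := Ico tau1 tt; split=> //; exact: lt_le_trans t1T.
  rewrite ger0_norm ?k0 //; apply: le_trans (cP n j t n0 j0 tt) _.
  by rewrite /wtilde !mulrA.
(* One bound for both: U1 controls u and, by [nb_coag], 2 c U1^2 controls the coagulation term. *)
pose U := U1 + 2 * c * U1 * U1.
have cUU : 0 < c * U1 * U1 by rewrite !mulr_gt0.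
have ctUU : 0 < ct * U1 * U1 by rewrite !mulr_gt0.
have cU : 0 < c * U1 by rewrite mulr_gt0.
exists U, (2 * ct * U1 * U1 + 4 * c * U1), th; split.
  by split=> //; rewrite /U; lra.
split=> //.
- by move=> t tt; apply: nb_le (uU t tt) _; rewrite /U; lra.
- move=> t tt; have := nb_coag wpos wmono wtpos (ltW c0) (kle t tt) (uU t tt) (uU t tt).
  by move/nb_le; apply; rewrite /U; lra.
move=> s t D st tt uD; have D0 := nb_ge0 uD.
have p0 : 0 <= `|t - s| `^ th by exact: powR_ge0.
have c'0 : 0 <= ct * `|t - s| `^ th by rewrite mulr_ge0 // ltW.
have kd : kernel_le w wt (fun n j => k n j t - k n j s) (ct * `|t - s| `^ th).
  by move=> n j n0 j0; rewrite mulrAC; exact: ctP.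
have := coag_diff wpos wmono wtpos (ltW c0) c'0 (kle t tt) (kle s st) kd (uU t tt) (uU s st) uD.
move/nb_le; apply.
have : 0 <= ct * U1 * U1 * D by rewrite mulr_ge0 // ltW.
have : 0 <= c * U1 * `|t - s| `^ th by rewrite mulr_ge0 // ltW.
lra.
Qed.

Lemma local_mild tau : 0 < tau -> (tau%:E < t1)%E -> forall t, 0 <= t <= tau ->
  (forall s, 0 <= s <= tau -> exists B, nb w (Kop k s (u s)) B) ->
  u t = S t u0 + seqint (fun s => S (t - s) (Kop k s (u s))) 0 t.
Proof.
move=> tau0 tau1 t tt Kb; have [ul uc uE] := mild.
have [Bu u0B] : exists B, nb w u0 B.
  by have [B /wt_w u0B] := (inl1P wtpos _).1 u0l; exists B.
have tI := Ico tau1 tt.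
apply/funext => -[|n]; last by rewrite !seqE (uE t tI).
have [t0 ttau] := andP tt.
have [B [S00 _]] := sg_nb Ssg t0 u0B.
rewrite !seqE S00 (ul t tI).1 add0r /seqint (@eq_Rintegral _ _ _ _ _ (fun=> 0)).
  by rewrite Rintegral_itv_cst // mulr0.
move=> s; rewrite inE /= in_itv /= => st.
have [|B' KB] := Kb s; first by lra.
have ts : 0 <= t - s by lra.
by have [B2 []] := sg_nb Ssg ts KB.
Qed.

Lemma local_regularity tau : 0 < tau -> (tau%:E < t1)%E ->
  [/\ (forall t, 0 < t <= tau -> Gdom w a b (u t) /\
         exists B, nb w (Gop a b (u t) + Kop k t (u t)) B),
      (forall t0, 0 < t0 ->
         ccont w (2 * t0) tau (fun t => Gop a b (u t) + Kop k t (u t))) &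
      (forall t e, 0 < t < tau -> 0 < e -> exists2 d, 0 < d & forall h,
         h != 0 -> `|h| < d ->
         nb w (h^-1 *: (u (t + h) - u t) - (Gop a b (u t) + Kop k t (u t))) e)].
Proof.
move=> tau0 tau1; have [al0 al1] := andP alpha01.
have [C C0 [Gan Ssm]] := smoothing.
have be01 : 0 < 1 - alpha < 1 by lra.
have [U [L [th [[U0 L0 th01] [ucc uU FU FH]]]]] := local_estimates tau0 tau1.
have [M M1 SM] := sg_bound wpos Ssg tau.
have uccw : ccont w 0 tau u.
  move=> z e zt e0; have [d d0 ud] := ucc z e zt e0.
  by exists d => // s st sz; apply/wt_w/ud.
have FB s : 0 <= s <= tau -> exists B, nb w (Kop k s (u s)) B.
  by move=> st; exists U; exact: FU.
have Fc : ccont w 0 tau (fun t => Kop k t (u t)).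
  move=> z e zt e0; have [th0 th1] := andP th01.
  have e2 : 0 < e / (2 * L) by rewrite divr_gt0 // mulr_gt0.
  have [d d0 ud] := ucc z (e / (2 * L)) zt e2.
  have d'0 : 0 < (e / (2 * L)) `^ th^-1 by exact: powR_gt0.
  exists (Num.min d ((e / (2 * L)) `^ th^-1)); first by rewrite lt_min d0.
  move=> s st; rewrite lt_min => /andP[sd sd'].
  apply: nb_le (FH _ _ _ zt st (ud s st sd)) _.
  have : `|s - z| `^ th <= e / (2 * L).
    have -> : e / (2 * L) = ((e / (2 * L)) `^ th^-1) `^ th.
      by rewrite -powRrM mulVf ?gt_eqF // powRr1 // ltW.
    by apply: ge0_ler_powR; rewrite ?nnegrE ?(ltW th0) ?(ltW d'0) // ltW.
  move=> ps; apply: (@le_trans _ _ (L * (e / (2 * L) + e / (2 * L)))).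
    by rewrite ler_wpM2l ?(ltW L0) // lerD2r.
  by rewrite le_eqVlt; apply/orP; left; apply/eqP; field; rewrite gt_eqF.
have [Bu u0B] : exists B, nb w u0 B.
  by have [B /wt_w u0B] := (inl1P wtpos _).1 u0l; exists B.
have mild' := mild_density wpos Ssg u0B Fc FB
  (fun t tt => local_mild tau0 tau1 tt FB).
have lim := lagW_limit wpos wtpos wt_w Ssg C0 be01 Gan Ssm M1 SM U0 uU FU mild' L0 th01 FH.
(* Taking t / 2 for [t0] just admits t; of the limit W only membership of u(t) in the domain is
   kept. *)
have uG t : 0 < t <= tau -> isgen w S (u t) (Gop a b (u t)).
  move=> tt; have t20 : 0 < t / 2 by lra.
  have [eta0 [_ _ lim']] := lim _ t20.
  have [|W Wg _] := lim' t; first by lra.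
  by have [Gd _] := (isgenP _ _).1 Wg; apply/isgenP.
split.
- move=> t tt; have [_ [B GB] _] := uG t tt.
  split; first by have /isgenP[] := uG t tt.
  by exists (B + U); apply: (nbD wpos) => //; apply: FU; lra.
- move=> t0 t00.
  exact: (rhs_cont wpos wtpos wt_w Ssg C0 be01 Gan Ssm M1 SM U0 uU FU mild' L0 th01 FH
    uccw Fc uG t00).
move=> t e tt e0.
exact: (mild_derivative wpos wtpos wt_w Ssg C0 be01 Gan Ssm M1 SM U0 uU FU mild' L0 th01 FH
    uccw Fc uG tt e0).
Qed.

End CoagulationFragmentation.

(** * Exhaustion of [0, t1) by compact intervals *)

Lemma ereal_gap {R : realType} (t : R) (x : \bar R) : (t%:E < x)%E ->
  exists2 tau, t < tau & (tau%:E < x)%E.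
Proof.
case: x => [r| |] //; last first.
  by move=> _; exists (t + 1); [rewrite ltrDl|rewrite ltry].
by rewrite lte_fin => tr; exists ((t + r) / 2); rewrite ?lte_fin; lra.
Qed.

Unset Implicit Arguments.

Theorem theorem4p15 (R : realType) (T : \bar R)
    (a : nat -> R) (b : nat -> nat -> R) (k : nat -> nat -> R -> R)
    (w : nat -> R) (kappa alpha : R)
    (S : R -> (nat -> R) -> (nat -> R)) (u0 : nat -> R)
    (t1 : \bar R) (u : R -> (nat -> R)) :
  (0 < T)%E ->
  (* standing assumptions *)
  (forall n, (0 < n)%N -> 0 <= a n) ->
  (forall n j, (0 < n)%N -> (0 < j)%N -> 0 <= b n j) ->
  (forall n j, (0 < n)%N -> (j <= n)%N -> b n j = 0) ->
  (forall n j, (0 < n)%N -> (0 < j)%N -> forall t, Ico0 T t -> 0 <= k n j t) ->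
  (forall n j, (0 < n)%N -> (0 < j)%N -> {within Ico0 T, continuous (k n j)}) ->
  (forall n j t, (0 < n)%N -> (0 < j)%N -> Ico0 T t -> k n j t = k j n t) ->
  (* the weight w, case (CII) *)
  (forall n, (0 < n)%N -> n%:R <= w n) ->
  (forall n m, (0 < n)%N -> (n <= m)%N -> w n <= w m) ->
  0 < kappa < 1 ->
  (forall j, (2 <= j)%N -> \sum_(1 <= n < j) w n * b n j <= kappa * w j) ->
  0 < alpha < 1 ->
  (forall t', 0 < t' -> (t'%:E < T)%E -> exists c : R, 0 < c /\
     forall n j t, (0 < n)%N -> (0 < j)%N -> 0 <= t <= t' ->
       k n j t <= c * wtilde alpha a w n * wtilde alpha a w j / w (n + j)%N) ->
  (* additional Hoelder continuity of the kernel *)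
  (forall t', 0 < t' -> (t'%:E < T)%E -> exists (ct theta : R),
     0 < ct /\ 0 < theta < 1 /\
     forall n j s t, (0 < n)%N -> (0 < j)%N -> 0 <= s <= t' -> 0 <= t <= t' ->
       `|k n j t - k n j s| <=
         ct * (wtilde alpha a w n * wtilde alpha a w j / w (n + j)%N) * (`|t - s| `^ theta)) ->
  (* (S(t)) is the (analytic) C0-semigroup on l^1_w generated by G^(w) *)
  generates w (Gdom w a b) (Gop a b) S ->
  analytic_sg w (Gdom w a b) (Gop a b) S ->
  (* initial datum in (l^1_{w~})_+ *)
  inl1 (wtilde alpha a w) u0 -> nonneg_seq u0 ->
  (* u is the maximal mild solution, on [0, t1) *)
  (0 < t1)%E -> (t1 <= T)%E ->
  mild_sol w (wtilde alpha a w) S k u0 t1 u ->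
  (forall (t2 : \bar R) (v : R -> (nat -> R)), (0 < t2)%E -> (t2 <= T)%E ->
     mild_sol w (wtilde alpha a w) S k u0 t2 v -> (t2 <= t1)%E) ->
  classical_sol w (wtilde alpha a w) a b k u0 t1 u.
Proof.
move=> _ a0 b0 b_upper k0 _ _ wn wmono kappa01 b_sum alpha01 kc kholder gen analytic
  u0l _ t1_gt0 t1T mild _.
have wpos n : (0 < n)%N -> 0 < w n by move=> n0; apply: lt_le_trans (wn n n0); rewrite ltr0n.
have wtpos n : (0 < n)%N -> 0 < wtilde alpha a w n by exact: wtilde_gt0.
have [ul uc uE] := mild.
have reg tau := local_regularity a0 b0 b_upper k0 wn wmono kappa01 b_sum alpha01 kc
  kholder gen analytic u0l t1T mild (tau := tau).
have uG t : Ioo0 t1 t -> Gdom w a b (u t).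
  move=> [t0 tt1]; have [Gd _ _] := reg t t0 tt1.
  by have [|] := Gd t; first by rewrite t0 lexx.
pose u' t := fun n => Gop a b (u t) n + Kop k t (u t) n.
have u'nb t : Ioo0 t1 t -> exists B, nb w (u' t) B.
  move=> [t0 tt1]; have [Gd _ _] := reg t t0 tt1.
  by have [|_ []] := Gd t; [rewrite t0 lexx|move=> B; exists B].
have u'0 t : Ioo0 t1 t -> u' t 0%N = 0 by move=> /u'nb[B []].
split=> //.
  have I0 : Ico0 t1 0 by split.
  apply/funext => -[|n]; first by rewrite (ul 0 I0).1 u0l.1.
  have u0w : exists B, nb w u0 B.
    have [B u0B] := (inl1P wtpos u0).1 u0l.
    by exists B; exact: nb_wtilde_w u0B.
  have [B u0B] := u0w.
  have [_ S0 _ _] := generates_sg wpos gen.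
  rewrite (uE 0 I0) // (S0 _ _ u0B) set_itv1 Rintegral_set1 addr0 //.
exists u'; split.
- by move=> t /u'nb/(inl1P wpos).
(* The derivative is two-sided, so [tau] is taken strictly between t and t1. *)
- move=> t [t0 tt1]; have [tau ttau tau1] := ereal_gap tt1.
  have tau0 : 0 < tau by lra.
  have [_ _ der] := reg tau tau0 tau1.
  apply/(wsum_cvg0 wpos) => e e0; apply/near_punctured0P.
  have [|d d0 dP] := der t e _ e0; first by rewrite t0.
  by exists d => // h h0 hd; have [_] := (nb_wsum wpos _ _).1 (dP h h0 hd).
- move=> t It; have [t0 tt1] := It; have [tau ttau tau1] := ereal_gap tt1.
  have tau0 : 0 < tau by lra.
  have [_ cont _] := reg tau tau0 tau1.
  apply/(wsum_cvg0 wpos) => e e0; apply/near_withinP.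
  (* With t / 4 for [t0], continuity holds on [t / 2, tau], to which t is interior. *)
  have t40 : 0 < t / 4 by lra.
  have [|d d0 dP] := cont (t / 4) t40 t e _ e0; first by lra.
  exists (Num.min d (Num.min (t / 2) (tau - t))).
    by rewrite !lt_min d0; lra.
  move=> s Is; rewrite !lt_min => /and3P[sd st stau].
  have [|_] := (nb_wsum wpos _ _).1 (dP s _ sd); last by [].
  by move: st stau; rewrite !ltr_norml; lra.
- exact: uG.
- by [].
Qed.
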